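(* Let $p\ge 5$ be an integer, let $x$ be a right vertex of $T_H$, and let $f$ be any $2p$ distance coloring of $T_H$. Then the number of colors appearing on $\bigcup_{q=1}^{2\lfloor p/2\rfloor-1}\mathcal{F}_{x,p+q}$ that do not appear on $V(D_x^{2p})$ is at least $\lfloor p/2\rfloor$, i.e. $$\Big|\, f\Big(\bigcup_{q=1}^{2\lfloor p/2\rfloor-1}\mathcal{F}_{x,p+q}\Big)\setminus f\big(V(D_x^{2p})\big)\Big| \ \ge\ \Big\lfloor \frac p2\Big\rfloor .$$ Consequently $\lambda^{2p}(T_H)\ge |V(D_x^{2p})|+\lfloor p/2\rfloor$.
   Context: $T_H$ is the infinite hexagonal grid with vertex set $\mathbb{Z}^2$: $(i,j)$ is adjacent to $(i,j\pm1)$, and $(i,j)$ is adjacent to $(i+1,j)$ iff $i+j$ is even; no other edges. A vertex $(i,j)$ with $i+j$ even is called a right vertex. $d(u,v)$ is graph distance. For $l\in\mathbb{N}$, an $l$ distance coloring is a map $f:V(T_H)\to\{1,\dots,n\}$ with $f(u)\ne f(v)$ for all distinct $u,v$ with $d(u,v)\le l$; $\lambda^l(T_H)$ is the minimum such $n$. For a vertex $x$ and integer $k\ge0$, $\mathcal{F}_{x,k}=\{u\in V(T_H): d(x,u)=k\}$. $D_x^{2p}$ is the subgraph of $T_H$ induced by $\{w: d(w,x)\le p\}$ (the maximal induced subgraph all of whose vertices are within distance $p$ of $x$; any two of its vertices are within distance $2p$). *)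

(* Defs.v *)
From Stdlib Require Import ZArith List Arith Lia.
Open Scope Z_scope.

(* Vertices of the hexagonal grid T_H: Z^2. *)
Definition vertex : Type := (Z * Z)%type.

Definition right_vertex (x : vertex) : Prop := Z.Even (fst x + snd x).

Definition adj (u v : vertex) : Prop :=
  (fst u = fst v /\ (snd v = snd u + 1 \/ snd v = snd u - 1)) \/
  (snd u = snd v /\
     ((fst v = fst u + 1 /\ Z.Even (fst u + snd u)) \/
      (fst u = fst v + 1 /\ Z.Even (fst v + snd v)))).

Fixpoint walk (u v : vertex) (k : nat) : Prop :=
  match k with
  | O => u = v
  | S k' => exists w, adj u w /\ walk w v k'
  end.

Definition dist_le (u v : vertex) (k : nat) : Prop :=
  exists m, (m <= k)%nat /\ walk u v m.

Definition dist_eq (u v : vertex) (k : nat) : Prop :=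
  walk u v k /\ forall m, (m < k)%nat -> ~ walk u v m.

Definition distance_coloring (l n : nat) (f : vertex -> nat) : Prop :=
  (forall v, (1 <= f v <= n)%nat) /\
  (forall u v, u <> v -> dist_le u v l -> f u <> f v).

(* Main.v *)
(** Put cube coordinates on the grid: a vertex becomes a triple [(a, b, c)] with
    [a + b + c] equal to 0 (right vertices) or 1 (left vertices), the origin being [x], and the
    graph distance becomes the l1 distance.  Write [p = 2 m + e] with [e] in [{0, 1}] and
    [range u] for the largest minus the smallest coordinate.

    Give the vertex [u] the weight [2 (3 m + 1 + e) - 2 range u], truncated at 0: a tent whose
    support is a hexagon rotated by 30 degrees with respect to the ball of radius [p].  Points
    at mutual distance at least [2 p + 1] have total weight at most [2 (3 m + 1)], once the
    weight has been corrected slightly on some vertices (see [weight]).  Hence so has every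
    colour class, and the number of colours on the support is at least the total weight divided
    by [2 (3 m + 1)].  That quotient exceeds the size of the ball of radius [p] plus [m - 1], so at
    least [m] colours of the support are missing from the ball. *)

Require Import Defs.
From Stdlib Require Import ZArith List Arith Lia Bool.
From Stdlib Require FinFun.
Import ListNotations.

(** * Cube coordinates *)

Definition cube : Type := (Z * Z * Z)%type.

Definition csum (u : cube) : Z := let '(a, b, c) := u in a + b + c.

Definition cgood (u : cube) : Prop := csum u = 0 \/ csum u = 1.

Definition cdist (u v : cube) : Z :=
  let '(a, b, c) := u in let '(a', b', c') := v in
  Z.abs (a - a') + Z.abs (b - b') + Z.abs (c - c').

(* [(a, b, c)] is reached from the right vertex [x] by [a] horizontal steps; [b] counts upward
   steps out of right vertices and [c] downward ones. *)
Definition emb (x : vertex) (u : cube) : vertex :=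
  let '(a, b, c) := u in (fst x + a, snd x + (b - c)).

Lemma emb_0 x : emb x (0, 0, 0) = x.
Proof. destruct x as [i j]; unfold emb; f_equal; simpl; lia. Qed.

(** Equal images give equal [a] and [b - c]; the two values of [b + c] then have the same parity and
    differ by at most 1, so they agree. *)
Lemma emb_inj x u v : cgood u -> cgood v -> emb x u = emb x v -> u = v.
Proof.
  destruct u as [[a b] c], v as [[a' b'] c']; unfold cgood, csum, emb.
  intros Hu Hv E; injection E; intros.
  assert (a = a') by lia; assert (b - c = b' - c') by lia.
  assert (b = b') by lia; assert (c = c') by lia; congruence.
Qed.

Lemma adj_emb_inv x u w : right_vertex x -> cgood u -> adj (emb x u) w ->
  exists t, cgood t /\ w = emb x t /\ cdist u t = 1.
Proof.
  destruct x as [i j], u as [[a b] c], w as [i' j'];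
    unfold right_vertex, cgood, csum, adj, emb; simpl.
  intros [k Hk] Hu Ha.
  assert (T : forall a' b' c', (a' + b' + c' = 0 \/ a' + b' + c' = 1) ->
    i' = i + a' -> j' = j + (b' - c') ->
    Z.abs (a - a') + Z.abs (b - b') + Z.abs (c - c') = 1 ->
    exists t, ((let '(a0, b0, c0) := t in a0 + b0 + c0) = 0 \/
       (let '(a0, b0, c0) := t in a0 + b0 + c0) = 1) /\
       (i', j') = (let '(a0, b0, c0) := t in (i + a0, j + (b0 - c0))) /\
       (let '(a', b', c') := t in Z.abs (a - a') + Z.abs (b - b') + Z.abs (c - c')) = 1).
  { intros a' b' c' H1 H2 H3 H4; exists (a', b', c').
    split; [exact H1 | split; [congruence | exact H4]]. }
  destruct Ha as [[Hi [Hj | Hj]] | [Hj [[Hi [q Hq]] | [Hi [q Hq]]]]]; destruct Hu as [Hu | Hu].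
  - apply (T a (b + 1) c); lia.
  - apply (T a b (c - 1)); lia.
  - apply (T a b (c + 1)); lia.
  - apply (T a (b - 1) c); lia.
  - apply (T (a + 1) b c); lia.
  (* A horizontal edge joins [(i, j)] to [(i + 1, j)] only for [i + j] even; this case and the next
     give its end the wrong parity. *)
  - exfalso; lia.
  - exfalso; lia.
  - apply (T (a - 1) b c); lia.
Qed.

(** Each step moves by l1 distance 1, so the l1 distance bounds the graph distance from below;
    [walk_emb] supplies the walk that attains it. *)
Lemma walk_emb_inv x k : right_vertex x -> forall u w, cgood u -> walk (emb x u) w k ->
  exists t, cgood t /\ w = emb x t /\ cdist u t <= Z.of_nat k.
Proof.
  intros Hx; induction k as [|k IH]; intros u w Hu.
  - simpl; intros <-; exists u; split; [exact Hu | split; [reflexivity |]].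
    destruct u as [[a b] c]; simpl; lia.
  - intros [w' [Ha Hw]].
    destruct (adj_emb_inv _ _ _ Hx Hu Ha) as [u' [Hu' [-> Hd]]].
    destruct (IH _ _ Hu' Hw) as [t [Ht [-> Hd']]].
    exists t; split; [exact Ht | split; [reflexivity |]].
    destruct u as [[a b] c], u' as [[a' b'] c'], t as [[a'' b''] c'']; simpl in *; lia.
Qed.

Lemma adj_emb x u v : right_vertex x -> cgood u -> cgood v -> cdist u v = 1 ->
  adj (emb x u) (emb x v).
Proof.
  destruct x as [i j], u as [[a b] c], v as [[a' b'] c'];
    unfold right_vertex, cgood, csum, cdist, adj, emb; simpl.
  intros [k Hk] Hu Hv Hd.
  destruct (Z.eq_dec a a') as [-> | Ha].
  - left; split; [reflexivity | lia].
  - right; split; [lia |].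
    destruct Hu as [Hu | Hu].
    + left; split; [lia | exists (k - c); lia].
    + right; split; [lia | exists (k - c); lia].
Qed.

Lemma walk_emb x k : right_vertex x -> forall u v, cgood u -> cgood v ->
  cdist u v = Z.of_nat k -> walk (emb x u) (emb x v) k.
Proof.
  intros Hx; induction k as [|k IH]; intros u v Hu Hv Hd.
  - simpl; f_equal.
    destruct u as [[a b] c], v as [[a' b'] c']; simpl in Hd.
    repeat f_equal; lia.
  - (* From a right vertex one coordinate can be increased, from a left one decreased. *)
    assert (S : exists t, cgood t /\ cdist u t = 1 /\ cdist t v = Z.of_nat k).
    { destruct u as [[a b] c], v as [[a' b'] c']; unfold cgood, csum, cdist in *.
      destruct Hu as [Hu | Hu].
      - destruct (Z_lt_dec a a'); [exists (a + 1, b, c); lia |].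
        destruct (Z_lt_dec b b'); [exists (a, b + 1, c); lia |].
        exists (a, b, c + 1); lia.
      - destruct (Z_lt_dec a' a); [exists (a - 1, b, c); lia |].
        destruct (Z_lt_dec b' b); [exists (a, b - 1, c); lia |].
        exists (a, b, c - 1); lia. }
    destruct S as [t [Ht [H1 H2]]].
    exists (emb x t); split; [apply adj_emb; assumption | apply IH; assumption].
Qed.

Lemma dist_eq_emb x u k : right_vertex x -> cgood u -> cdist (0, 0, 0) u = Z.of_nat k ->
  dist_eq x (emb x u) k.
Proof.
  intros Hx Hu Hk.
  assert (H0 : cgood (0, 0, 0)) by (left; reflexivity).
  rewrite <- (emb_0 x) at 1; split; [apply walk_emb; assumption |].
  intros q Hq Hw.
  destruct (walk_emb_inv _ _ Hx _ _ H0 Hw) as [t [Ht [E Hd]]].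
  apply emb_inj in E; [subst t; lia | assumption | assumption].
Qed.

Lemma dist_le_emb x u v k : right_vertex x -> cgood u -> cgood v -> cdist u v <= Z.of_nat k ->
  dist_le (emb x u) (emb x v) k.
Proof.
  intros Hx Hu Hv Hk.
  assert (0 <= cdist u v) by (destruct u as [[a b] c], v as [[a' b'] c']; simpl; lia).
  exists (Z.to_nat (cdist u v)); split; [lia |].
  apply walk_emb; try assumption; lia.
Qed.

Lemma dist_le_inv x w k : right_vertex x -> dist_le x w k ->
  exists u, cgood u /\ w = emb x u /\ cdist (0, 0, 0) u <= Z.of_nat k.
Proof.
  intros Hx [q [Hq Hw]].
  rewrite <- (emb_0 x) in Hw.
  destruct (walk_emb_inv _ _ Hx (0, 0, 0) w (or_introl eq_refl) Hw) as [t [Ht [E Hd]]].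
  exists t; split; [exact Ht | split; [exact E | lia]].
Qed.

(** * The tent weight and its sectors *)

Inductive axis := AX | AY | AZ.

Definition co (i : axis) (u : cube) : Z :=
  let '(a, b, c) := u in match i with AX => a | AY => b | AZ => c end.

Definition perm (i j k : axis) : Prop := i <> j /\ j <> k /\ k <> i.

Definition cnorm (u : cube) : Z := cdist (0, 0, 0) u.

Definition range (u : cube) : Z :=
  let '(a, b, c) := u in Z.max a (Z.max b c) - Z.min a (Z.min b c).

(* The vertices on the axes of the tent's kinks, [(2 s, - s, - s)] and [(s, s, 1 - 2 s)] up to
   permutation; the other two families, [(- 2 s, s, s)] and [(- s, - s, 2 s + 1)], are left out. *)
Definition middle (u : cube) : bool :=
  let '(a, b, c) := u in
  let t := if a =? b then a else if b =? c then b else if c =? a then c else 0 in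
  ((csum u =? 0) && (t <? 0)) || ((csum u =? 1) && (0 <? t)).

(* Three corrections to the tent: the colours of the vertices near the origin cannot reappear, so
   these vertices carry a full class; vertices beyond distance [4 m + e - 1] are not considered;
   and lowering the middle vertices repairs the triples (for odd [p] also the pairs) of far
   points on which the tent alone is too large by rounding. *)
Definition weight (m e : Z) (u : cube) : Z :=
  if cnorm u <=? 1 + e then 2 * (3 * m + 1)
  else if 4 * m + e - 1 <? cnorm u then 0
  else Z.max 0 (2 * (3 * m + 1 + e) - 2 * range u
                - if middle u && (2 * m + 2 <=? cnorm u) then 1 + e else 0).

Definition far (m e : Z) (u v : cube) : Prop := 2 * (2 * m + e) + 1 <= cdist u v.

Definition outer (m e : Z) (u : cube) : Prop :=
  cgood u /\ 2 + e <= cnorm u <= 4 * m + e - 1 /\ 0 < weight m e u.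

(* The six sectors of 60 degrees cut out by the signs of the coordinates: two far points of the
   support are never in the same one. *)
Definition secP (i : axis) (u : cube) : bool :=
  let '(a, b, c) := u in
  match i with
  | AX => (0 <? a) && (b <=? 0) && (c <=? 0)
  | AY => (0 <? b) && (c <=? 0) && (a <=? 0)
  | AZ => (0 <? c) && (a <=? 0) && (b <=? 0)
  end.

Definition secM (i : axis) (u : cube) : bool :=
  let '(a, b, c) := u in
  match i with
  | AX => (a <=? 0) && (0 <? b) && (0 <? c)
  | AY => (b <=? 0) && (0 <? c) && (0 <? a)
  | AZ => (c <=? 0) && (0 <? a) && (0 <? b)
  end.

(* The constraints on a point of [secP i] ([sg = 1]) or [secM i] ([sg = -1]), in linear form. *)
Definition sector_bounds (m e : Z) (i j k : axis) (sg : Z) (u : cube) : Prop :=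
  (co i u + co j u + co k u = 0 \/ co i u + co j u + co k u = 1) /\
  2 + e <= sg * (co i u - co j u - co k u) <= 4 * m + e - 1 /\
  0 < weight m e u /\
  weight m e u <= 2 * (3 * m + 1 + e) - 2 * (sg * (co i u - co j u)) /\
  weight m e u <= 2 * (3 * m + 1 + e) - 2 * (sg * (co i u - co k u)) /\
  (co j u = co k u -> co i u + co j u + co k u = (1 - sg) / 2 ->
     2 * m + 2 <= sg * (co i u - co j u - co k u) ->
     weight m e u <= 2 * (3 * m + 1 + e) - 2 * (sg * (co i u - co j u)) - (1 + e)).

Ltac bool_lia :=
  repeat match goal with
  | H : _ && _ = true |- _ => apply andb_prop in H; destruct H
  | H : (_ <? _) = true |- _ => apply Z.ltb_lt in H
  | H : (_ <=? _) = true |- _ => apply Z.leb_le in H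
  end.

Lemma outer_weight m e u : outer m e u ->
  weight m e u = 2 * (3 * m + 1 + e) - 2 * range u
                 - if middle u && (2 * m + 2 <=? cnorm u) then 1 + e else 0.
Proof.
  unfold outer, weight; intros [_ [Hn Hw]].
  destruct (Z.leb_spec (cnorm u) (1 + e)); [lia |].
  destruct (Z.ltb_spec (4 * m + e - 1) (cnorm u)); lia.
Qed.

Ltac sector_cases :=
  repeat match goal with H : perm _ _ _ |- _ => destruct H as [? [? ?]] end;
  repeat match goal with i : axis |- _ => destruct i end; try congruence;
  repeat match goal with u : cube |- _ => destruct u as [[? ?] ?] end.

(** In [secM i] the coordinate [i] is the smallest, so the norm becomes linear and the range is the
    larger of two differences, which yields two linear bounds on the weight. [secP_bounds] is the
    mirror image. *)
Lemma secM_bounds m e i j k u : 0 <= e -> perm i j k -> outer m e u -> secM i u = true ->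
  sector_bounds m e i j k (-1) u.
Proof.
  intros He Hp Ho Hs; pose proof (outer_weight _ _ _ Ho) as Hw.
  destruct Ho as [Hg [Hn Hpos]]; unfold sector_bounds.
  change ((1 - -1) / 2) with 1.
  generalize dependent (weight m e u); intros w Hpos Hw; revert Hw Hn Hg Hs.
  unfold middle, cnorm; sector_cases;
  unfold secM, co, range, cgood, csum, cdist; intros Hw Hn Hg Hs; bool_lia;
  (* The first five bounds need only that the middle correction is nonnegative; the last one needs
     its exact value. *)
  match type of Hw with
  | context [if ?b then ?x else ?y] => assert (0 <= if b then x else y) by (destruct b; lia)
  end;
  (repeat split; [lia .. |]; intros E1 E2 E3; subst w;
   match goal with |- context [if ?b then _ else _] => replace b with true; [lia |] end;
   symmetry; apply andb_true_intro; split; [| apply Z.leb_le; lia];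
   apply orb_true_intro; right; apply andb_true_intro;
   split; [apply Z.eqb_eq; lia | apply Z.ltb_lt];
   repeat match goal with |- context [?x =? ?y] => destruct (Z.eqb_spec x y) end; lia).
Qed.

Lemma secP_bounds m e i j k u : 0 <= e -> perm i j k -> outer m e u -> secP i u = true ->
  sector_bounds m e i j k 1 u.
Proof.
  intros He Hp Ho Hs; pose proof (outer_weight _ _ _ Ho) as Hw.
  destruct Ho as [Hg [Hn Hpos]]; unfold sector_bounds.
  change ((1 - 1) / 2) with 0.
  generalize dependent (weight m e u); intros w Hpos Hw; revert Hw Hn Hg Hs.
  unfold middle, cnorm; sector_cases;
  unfold secP, co, range, cgood, csum, cdist; intros Hw Hn Hg Hs; bool_lia;
  match type of Hw with
  | context [if ?b then ?x else ?y] => assert (0 <= if b then x else y) by (destruct b; lia)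
  end;
  (repeat split; [lia .. |]; intros E1 E2 E3; subst w;
   match goal with |- context [if ?b then _ else _] => replace b with true; [lia |] end;
   symmetry; apply andb_true_intro; split; [| apply Z.leb_le; lia];
   apply orb_true_intro; left; apply andb_true_intro;
   split; [apply Z.eqb_eq; lia | apply Z.ltb_lt];
   repeat match goal with |- context [?x =? ?y] => destruct (Z.eqb_spec x y) end; lia).
Qed.

(** * Distances between far points in two given sectors, in linear form *)

Definition packing (m e : Z) (l : list cube) : Prop :=
  (forall u, In u l -> outer m e u) /\
  (forall u v, In u l -> In v l -> u <> v -> far m e u v).

Lemma far_co m e i j k u v : perm i j k -> far m e u v ->
  2 * (2 * m + e) + 1 <=
    Z.abs (co i u - co i v) + Z.abs (co j u - co j v) + Z.abs (co k u - co k v).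
Proof. unfold far; intros; sector_cases; unfold co, cdist in *; lia. Qed.

Lemma secM_co i j k u : perm i j k -> secM i u = true -> co i u <= 0 /\ 0 < co j u /\ 0 < co k u.
Proof. intros; sector_cases; unfold co, secM in *; bool_lia; lia. Qed.

Lemma secP_co i j k u : perm i j k -> secP i u = true -> 0 < co i u /\ co j u <= 0 /\ co k u <= 0.
Proof. intros; sector_cases; unfold co, secP in *; bool_lia; lia. Qed.

Lemma packing_secM m e l i j k u : 0 <= e -> perm i j k -> packing m e l -> In u l ->
  secM i u = true -> sector_bounds m e i j k (-1) u /\ co i u <= 0 /\ 0 < co j u /\ 0 < co k u.
Proof.
  intros He Hp [Ho _] Hu Hs; split; [| apply secM_co; assumption].
  apply secM_bounds; auto.
Qed.

Lemma packing_secP m e l i j k u : 0 <= e -> perm i j k -> packing m e l -> In u l ->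
  secP i u = true -> sector_bounds m e i j k 1 u /\ 0 < co i u /\ co j u <= 0 /\ co k u <= 0.
Proof.
  intros He Hp [Ho _] Hu Hs; split; [| apply secP_co; assumption].
  apply secP_bounds; auto.
Qed.

(** In opposite sectors the signs of the coordinates decide all three absolute values. For two
    sectors of the same kind, as in [packing_PP] and [packing_MM], they decide two; the one along
    [k] stays. *)
Lemma packing_opposite m e l i j k u v : perm i j k -> packing m e l -> In u l -> In v l ->
  secM i u = true -> secP i v = true ->
  2 * (2 * m + e) + 1 <=
    (co i v - co i u) + (co j u - co j v) + (co k u - co k v).
Proof.
  intros Hp [_ Hf] Hu Hv Su Sv.
  pose proof (secM_co _ _ _ _ Hp Su); pose proof (secP_co _ _ _ _ Hp Sv).
  assert (Hn : u <> v) by (intros ->; lia).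
  pose proof (far_co _ _ _ _ _ _ _ Hp (Hf _ _ Hu Hv Hn)); lia.
Qed.

Lemma packing_PP m e l i j k u v : perm i j k -> packing m e l -> In u l -> In v l ->
  secP i u = true -> secP j v = true ->
  2 * (2 * m + e) + 1 <=
    (co i u - co i v) + (co j v - co j u) + Z.abs (co k u - co k v).
Proof.
  intros Hp [_ Hf] Hu Hv Su Sv.
  assert (Hq : perm j i k) by (unfold perm in *; intuition congruence).
  pose proof (secP_co _ _ _ _ Hp Su); pose proof (secP_co _ _ _ _ Hq Sv).
  assert (Hn : u <> v) by (intros ->; lia).
  pose proof (far_co _ _ _ _ _ _ _ Hp (Hf _ _ Hu Hv Hn)); lia.
Qed.

Lemma packing_MM m e l i j k u v : perm i j k -> packing m e l -> In u l -> In v l ->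
  secM i u = true -> secM j v = true ->
  2 * (2 * m + e) + 1 <=
    (co i v - co i u) + (co j u - co j v) + Z.abs (co k u - co k v).
Proof.
  intros Hp [_ Hf] Hu Hv Su Sv.
  assert (Hq : perm j i k) by (unfold perm in *; intuition congruence).
  pose proof (secM_co _ _ _ _ Hp Su); pose proof (secM_co _ _ _ _ Hq Sv).
  assert (Hn : u <> v) by (intros ->; lia).
  pose proof (far_co _ _ _ _ _ _ _ Hp (Hf _ _ Hu Hv Hn)); lia.
Qed.

(* Of the four sign patterns for the differences [co i u - co i v] and [co j u - co j v], only
   one leaves room for a distance of [2 p + 1]; so the absolute values disappear. *)
Lemma packing_adjacent m e l i j k u v : 0 <= e -> perm i j k -> packing m e l ->
  In u l -> In v l -> secM i u = true -> secP j v = true ->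
  2 * (2 * m + e) + 1 <= 2 * (co k u - co k v) + (co i v + co j v + co k v)
                         - (co i u + co j u + co k u).
Proof.
  intros He Hp Hl Hu Hv Su Sv.
  assert (Hq : perm j i k) by (unfold perm in *; intuition congruence).
  destruct (packing_secM _ _ _ _ _ _ _ He Hp Hl Hu Su) as [(Gu & Nu & _) Cu].
  destruct (packing_secP _ _ _ _ _ _ _ He Hq Hl Hv Sv) as [(Gv & Nv & _) Cv].
  assert (Hn : u <> v) by (intros ->; lia).
  destruct Hl as [_ Hf].
  pose proof (far_co _ _ _ _ _ _ _ Hp (Hf _ _ Hu Hv Hn)); lia.
Qed.

(** * Total weight of far points, for each pattern of occupied sectors *)

Ltac split_abs :=
  repeat match goal with
  | H : context [Z.abs ?x] |- _ =>
      let E := fresh in destruct (Z.abs_spec x) as [[? E] | [? E]]; rewrite E in *; clear E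
  end.


Lemma perm_all i j k : perm i j k ->
  perm i k j /\ perm j i k /\ perm j k i /\ perm k i j /\ perm k j i.
Proof. unfold perm; intuition congruence. Qed.

Ltac start_sectors :=
  lazymatch goal with He : ?e = 0 \/ ?e = 1, Hp : perm _ _ _ |- _ =>
    pose proof Hp as pijk; destruct (perm_all _ _ _ Hp) as (pikj & pjik & pjki & pkij & pkji);
    assert (He0 : 0 <= e) by lia
  end.
Ltac pointMmid p I S :=
  match goal with He0 : 0 <= _, Hl : packing _ _ _ |- _ =>
  destruct (packing_secM _ _ _ _ _ _ _ He0 p Hl I S) as [(? & ? & ? & ? & ? & ?) (? & ? & ?)]
  end; change ((1 - -1) / 2) with 1 in *.
Ltac pointPmid p I S :=
  match goal with He0 : 0 <= _, Hl : packing _ _ _ |- _ =>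
  destruct (packing_secP _ _ _ _ _ _ _ He0 p Hl I S) as [(? & ? & ? & ? & ? & ?) (? & ? & ?)]
  end; change ((1 - 1) / 2) with 0 in *.
Ltac pointM p I S :=
  match goal with He0 : 0 <= _, Hl : packing _ _ _ |- _ =>
  destruct (packing_secM _ _ _ _ _ _ _ He0 p Hl I S) as [(? & ? & ? & ? & ? & _) (? & ? & ?)]
  end.
Ltac pointP p I S :=
  match goal with He0 : 0 <= _, Hl : packing _ _ _ |- _ =>
  destruct (packing_secP _ _ _ _ _ _ _ He0 p Hl I S) as [(? & ? & ? & ? & ? & _) (? & ? & ?)]
  end.
(** Once the absolute values are split and every coordinate sum is fixed to 0 or 1, what remains is
    a problem in linear integer arithmetic. *)
Ltac finish_sectors :=
  repeat match goal with
  | H : packing _ _ _ |- _ => clear H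
  | H : perm _ _ _ |- _ => clear H
  | H : In _ _ |- _ => clear H
  | H : _ = true |- _ => clear H
  end;
  split_abs;
  repeat match goal with H : ?a = 0 \/ ?a = 1 |- _ => destruct H end; lia.

(** The tent alone exceeds the bound only for [e = 1], with [u0] a left and [u1] a right vertex,
    both middle, at distance exactly [2 p + 1]. The excess is 2, and one of the two norms is then at
    least [2 m + 2], so that point is lowered by 2. *)
Lemma pair_MP m e l i j k u0 u1 : e = 0 \/ e = 1 -> 2 <= m ->
  perm i j k -> packing m e l ->
  In u0 l -> secM i u0 = true ->
  In u1 l -> secP i u1 = true ->
  weight m e u0 + weight m e u1 <= 2 * (3 * m + 1).
Proof.
  intros He Hm Hp Hl I0 S0 I1 S1.
  start_sectors.
  pointMmid pijk I0 S0.
  pointPmid pijk I1 S1.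
  pose proof (packing_opposite _ _ _ _ _ _ _ _ pijk Hl I0 I1 S0 S1).
  finish_sectors.
Qed.

Lemma pair_MP_adj m e l i j k u0 u1 : e = 0 \/ e = 1 -> 2 <= m ->
  perm i j k -> packing m e l ->
  In u0 l -> secM i u0 = true ->
  In u1 l -> secP j u1 = true ->
  weight m e u0 + weight m e u1 <= 2 * (3 * m + 1).
Proof.
  intros He Hm Hp Hl I0 S0 I1 S1.
  start_sectors.
  pointM pijk I0 S0.
  pointP pjik I1 S1.
  pose proof (packing_adjacent _ _ _ _ _ _ _ _ He0 pijk Hl I0 I1 S0 S1).
  finish_sectors.
Qed.

Lemma pair_MM m e l i j k u0 u1 : e = 0 \/ e = 1 -> 2 <= m ->
  perm i j k -> packing m e l ->
  In u0 l -> secM i u0 = true ->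
  In u1 l -> secM j u1 = true ->
  weight m e u0 + weight m e u1 <= 2 * (3 * m + 1).
Proof.
  intros He Hm Hp Hl I0 S0 I1 S1.
  start_sectors.
  pointM pijk I0 S0.
  pointM pjik I1 S1.
  pose proof (packing_MM _ _ _ _ _ _ _ _ pijk Hl I0 I1 S0 S1).
  finish_sectors.
Qed.

Lemma pair_PP m e l i j k u0 u1 : e = 0 \/ e = 1 -> 2 <= m ->
  perm i j k -> packing m e l ->
  In u0 l -> secP i u0 = true ->
  In u1 l -> secP j u1 = true ->
  weight m e u0 + weight m e u1 <= 2 * (3 * m + 1).
Proof.
  intros He Hm Hp Hl I0 S0 I1 S1.
  start_sectors.
  pointP pijk I0 S0.
  pointP pjik I1 S1.
  pose proof (packing_PP _ _ _ _ _ _ _ _ pijk Hl I0 I1 S0 S1).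
  finish_sectors.
Qed.

(** In the sum of the three distances each axis counts twice its spread, with the minimum of axis
    [i] at the point of [secM i]. If the three maxima can be taken at different points, the total
    range is at least half that sum and the tent suffices; the middle corrections can matter only
    when one point holds two maxima. [triple_PPP] is the same with minima and maxima exchanged. *)
Lemma triple_MMM m e l i j k u0 u1 u2 : e = 0 \/ e = 1 -> 2 <= m ->
  perm i j k -> packing m e l ->
  In u0 l -> secM i u0 = true ->
  In u1 l -> secM j u1 = true ->
  In u2 l -> secM k u2 = true ->
  weight m e u0 + weight m e u1 + weight m e u2 <= 2 * (3 * m + 1).
Proof.
  intros He Hm Hp Hl I0 S0 I1 S1 I2 S2.
  start_sectors.
  pointMmid pijk I0 S0.
  pointMmid pjik I1 S1.
  pointMmid pkij I2 S2.
  pose proof (packing_MM _ _ _ _ _ _ _ _ pijk Hl I0 I1 S0 S1).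
  pose proof (packing_MM _ _ _ _ _ _ _ _ pikj Hl I0 I2 S0 S2).
  pose proof (packing_MM _ _ _ _ _ _ _ _ pjki Hl I1 I2 S1 S2).
  finish_sectors.
Qed.

Lemma triple_PPP m e l i j k u0 u1 u2 : e = 0 \/ e = 1 -> 2 <= m ->
  perm i j k -> packing m e l ->
  In u0 l -> secP i u0 = true ->
  In u1 l -> secP j u1 = true ->
  In u2 l -> secP k u2 = true ->
  weight m e u0 + weight m e u1 + weight m e u2 <= 2 * (3 * m + 1).
Proof.
  intros He Hm Hp Hl I0 S0 I1 S1 I2 S2.
  start_sectors.
  pointPmid pijk I0 S0.
  pointPmid pjik I1 S1.
  pointPmid pkij I2 S2.
  pose proof (packing_PP _ _ _ _ _ _ _ _ pijk Hl I0 I1 S0 S1).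
  pose proof (packing_PP _ _ _ _ _ _ _ _ pikj Hl I0 I2 S0 S2).
  pose proof (packing_PP _ _ _ _ _ _ _ _ pjki Hl I1 I2 S1 S2).
  finish_sectors.
Qed.

Lemma triple_MPP m e l i j k u0 u1 u2 : e = 0 \/ e = 1 -> 2 <= m ->
  perm i j k -> packing m e l ->
  In u0 l -> secM i u0 = true ->
  In u1 l -> secP i u1 = true ->
  In u2 l -> secP j u2 = true ->
  weight m e u0 + weight m e u1 + weight m e u2 <= 2 * (3 * m + 1).
Proof.
  intros He Hm Hp Hl I0 S0 I1 S1 I2 S2.
  start_sectors.
  pointM pijk I0 S0.
  pointP pijk I1 S1.
  pointP pjik I2 S2.
  pose proof (packing_opposite _ _ _ _ _ _ _ _ pijk Hl I0 I1 S0 S1).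
  pose proof (packing_adjacent _ _ _ _ _ _ _ _ He0 pijk Hl I0 I2 S0 S2).
  pose proof (packing_PP _ _ _ _ _ _ _ _ pijk Hl I1 I2 S1 S2).
  finish_sectors.
Qed.

Lemma triple_MMP m e l i j k u0 u1 u2 : e = 0 \/ e = 1 -> 2 <= m ->
  perm i j k -> packing m e l ->
  In u0 l -> secM i u0 = true ->
  In u1 l -> secM j u1 = true ->
  In u2 l -> secP i u2 = true ->
  weight m e u0 + weight m e u1 + weight m e u2 <= 2 * (3 * m + 1).
Proof.
  intros He Hm Hp Hl I0 S0 I1 S1 I2 S2.
  start_sectors.
  pointM pijk I0 S0.
  pointM pjik I1 S1.
  pointP pijk I2 S2.
  pose proof (packing_MM _ _ _ _ _ _ _ _ pijk Hl I0 I1 S0 S1).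
  pose proof (packing_opposite _ _ _ _ _ _ _ _ pijk Hl I0 I2 S0 S2).
  pose proof (packing_adjacent _ _ _ _ _ _ _ _ He0 pjik Hl I1 I2 S1 S2).
  finish_sectors.
Qed.

Lemma triple_MPP_adj m e l i j k u0 u1 u2 : e = 0 \/ e = 1 -> 2 <= m ->
  perm i j k -> packing m e l ->
  In u0 l -> secM i u0 = true ->
  In u1 l -> secP j u1 = true ->
  In u2 l -> secP k u2 = true ->
  weight m e u0 + weight m e u1 + weight m e u2 <= 2 * (3 * m + 1).
Proof.
  intros He Hm Hp Hl I0 S0 I1 S1 I2 S2.
  start_sectors.
  pointM pijk I0 S0.
  pointP pjik I1 S1.
  pointP pkij I2 S2.
  pose proof (packing_adjacent _ _ _ _ _ _ _ _ He0 pijk Hl I0 I1 S0 S1).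
  pose proof (packing_adjacent _ _ _ _ _ _ _ _ He0 pikj Hl I0 I2 S0 S2).
  pose proof (packing_PP _ _ _ _ _ _ _ _ pjki Hl I1 I2 S1 S2).
  finish_sectors.
Qed.

Lemma triple_MMP_adj m e l i j k u0 u1 u2 : e = 0 \/ e = 1 -> 2 <= m ->
  perm i j k -> packing m e l ->
  In u0 l -> secM i u0 = true ->
  In u1 l -> secM j u1 = true ->
  In u2 l -> secP k u2 = true ->
  weight m e u0 + weight m e u1 + weight m e u2 <= 2 * (3 * m + 1).
Proof.
  intros He Hm Hp Hl I0 S0 I1 S1 I2 S2.
  start_sectors.
  pointM pijk I0 S0.
  pointM pjik I1 S1.
  pointP pkij I2 S2.
  pose proof (packing_MM _ _ _ _ _ _ _ _ pijk Hl I0 I1 S0 S1).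
  pose proof (packing_adjacent _ _ _ _ _ _ _ _ He0 pikj Hl I0 I2 S0 S2).
  pose proof (packing_adjacent _ _ _ _ _ _ _ _ He0 pjki Hl I1 I2 S1 S2).
  finish_sectors.
Qed.

Lemma quad_MPPP m e l i j k u0 u1 u2 u3 : e = 0 \/ e = 1 -> 2 <= m ->
  perm i j k -> packing m e l ->
  In u0 l -> secM i u0 = true ->
  In u1 l -> secP i u1 = true ->
  In u2 l -> secP j u2 = true ->
  In u3 l -> secP k u3 = true ->
  weight m e u0 + weight m e u1 + weight m e u2 + weight m e u3 <= 2 * (3 * m + 1).
Proof.
  intros He Hm Hp Hl I0 S0 I1 S1 I2 S2 I3 S3.
  start_sectors.
  pointM pijk I0 S0.
  pointP pijk I1 S1.
  pointP pjik I2 S2.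
  pointP pkij I3 S3.
  pose proof (packing_opposite _ _ _ _ _ _ _ _ pijk Hl I0 I1 S0 S1).
  pose proof (packing_adjacent _ _ _ _ _ _ _ _ He0 pijk Hl I0 I2 S0 S2).
  pose proof (packing_adjacent _ _ _ _ _ _ _ _ He0 pikj Hl I0 I3 S0 S3).
  pose proof (packing_PP _ _ _ _ _ _ _ _ pijk Hl I1 I2 S1 S2).
  pose proof (packing_PP _ _ _ _ _ _ _ _ pikj Hl I1 I3 S1 S3).
  pose proof (packing_PP _ _ _ _ _ _ _ _ pjki Hl I2 I3 S2 S3).
  finish_sectors.
Qed.

Lemma quad_MMMP m e l i j k u0 u1 u2 u3 : e = 0 \/ e = 1 -> 2 <= m ->
  perm i j k -> packing m e l ->
  In u0 l -> secM i u0 = true ->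
  In u1 l -> secM j u1 = true ->
  In u2 l -> secM k u2 = true ->
  In u3 l -> secP i u3 = true ->
  weight m e u0 + weight m e u1 + weight m e u2 + weight m e u3 <= 2 * (3 * m + 1).
Proof.
  intros He Hm Hp Hl I0 S0 I1 S1 I2 S2 I3 S3.
  start_sectors.
  pointM pijk I0 S0.
  pointM pjik I1 S1.
  pointM pkij I2 S2.
  pointP pijk I3 S3.
  pose proof (packing_MM _ _ _ _ _ _ _ _ pijk Hl I0 I1 S0 S1).
  pose proof (packing_MM _ _ _ _ _ _ _ _ pikj Hl I0 I2 S0 S2).
  pose proof (packing_opposite _ _ _ _ _ _ _ _ pijk Hl I0 I3 S0 S3).
  pose proof (packing_MM _ _ _ _ _ _ _ _ pjki Hl I1 I2 S1 S2).
  pose proof (packing_adjacent _ _ _ _ _ _ _ _ He0 pjik Hl I1 I3 S1 S3).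
  pose proof (packing_adjacent _ _ _ _ _ _ _ _ He0 pkij Hl I2 I3 S2 S3).
  finish_sectors.
Qed.

Lemma quad_MMPP m e l i j k u0 u1 u2 u3 : e = 0 \/ e = 1 -> 2 <= m ->
  perm i j k -> packing m e l ->
  In u0 l -> secM i u0 = true ->
  In u1 l -> secM j u1 = true ->
  In u2 l -> secP i u2 = true ->
  In u3 l -> secP j u3 = true ->
  weight m e u0 + weight m e u1 + weight m e u2 + weight m e u3 <= 2 * (3 * m + 1).
Proof.
  intros He Hm Hp Hl I0 S0 I1 S1 I2 S2 I3 S3.
  start_sectors.
  pointM pijk I0 S0.
  pointM pjik I1 S1.
  pointP pijk I2 S2.
  pointP pjik I3 S3.
  pose proof (packing_MM _ _ _ _ _ _ _ _ pijk Hl I0 I1 S0 S1).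
  pose proof (packing_opposite _ _ _ _ _ _ _ _ pijk Hl I0 I2 S0 S2).
  pose proof (packing_adjacent _ _ _ _ _ _ _ _ He0 pijk Hl I0 I3 S0 S3).
  pose proof (packing_adjacent _ _ _ _ _ _ _ _ He0 pjik Hl I1 I2 S1 S2).
  pose proof (packing_opposite _ _ _ _ _ _ _ _ pjik Hl I1 I3 S1 S3).
  pose proof (packing_PP _ _ _ _ _ _ _ _ pijk Hl I2 I3 S2 S3).
  finish_sectors.
Qed.

Lemma quad_MMPP_adj m e l i j k u0 u1 u2 u3 : e = 0 \/ e = 1 -> 2 <= m ->
  perm i j k -> packing m e l ->
  In u0 l -> secM i u0 = true ->
  In u1 l -> secM j u1 = true ->
  In u2 l -> secP i u2 = true ->
  In u3 l -> secP k u3 = true ->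
  weight m e u0 + weight m e u1 + weight m e u2 + weight m e u3 <= 2 * (3 * m + 1).
Proof.
  intros He Hm Hp Hl I0 S0 I1 S1 I2 S2 I3 S3.
  start_sectors.
  pointM pijk I0 S0.
  pointM pjik I1 S1.
  pointP pijk I2 S2.
  pointP pkij I3 S3.
  pose proof (packing_MM _ _ _ _ _ _ _ _ pijk Hl I0 I1 S0 S1).
  pose proof (packing_opposite _ _ _ _ _ _ _ _ pijk Hl I0 I2 S0 S2).
  pose proof (packing_adjacent _ _ _ _ _ _ _ _ He0 pikj Hl I0 I3 S0 S3).
  pose proof (packing_adjacent _ _ _ _ _ _ _ _ He0 pjik Hl I1 I2 S1 S2).
  pose proof (packing_adjacent _ _ _ _ _ _ _ _ He0 pjki Hl I1 I3 S1 S3).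
  pose proof (packing_PP _ _ _ _ _ _ _ _ pikj Hl I2 I3 S2 S3).
  finish_sectors.
Qed.

(** The five points are listed in cyclic order around the origin, starting after the empty sector
    [secM j]. *)
Lemma quint_MMPPP m e l i j k u0 u1 u2 u3 u4 : e = 0 \/ e = 1 -> 2 <= m ->
  perm i j k -> packing m e l ->
  In u0 l -> secP i u0 = true ->
  In u1 l -> secM k u1 = true ->
  In u2 l -> secP j u2 = true ->
  In u3 l -> secM i u3 = true ->
  In u4 l -> secP k u4 = true ->
  weight m e u0 + weight m e u1 + weight m e u2 + weight m e u3 + weight m e u4 <= 2 * (3 * m + 1).
Proof.
  intros He Hm Hp Hl I0 S0 I1 S1 I2 S2 I3 S3 I4 S4.
  start_sectors.
  pointP pijk I0 S0.
  pointM pkij I1 S1.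
  pointP pjik I2 S2.
  pointM pijk I3 S3.
  pointP pkij I4 S4.
  pose proof (packing_adjacent _ _ _ _ _ _ _ _ He0 pkij Hl I1 I0 S1 S0).
  pose proof (packing_PP _ _ _ _ _ _ _ _ pijk Hl I0 I2 S0 S2).
  pose proof (packing_opposite _ _ _ _ _ _ _ _ pijk Hl I3 I0 S3 S0).
  pose proof (packing_PP _ _ _ _ _ _ _ _ pikj Hl I0 I4 S0 S4).
  pose proof (packing_adjacent _ _ _ _ _ _ _ _ He0 pkji Hl I1 I2 S1 S2).
  pose proof (packing_MM _ _ _ _ _ _ _ _ pkij Hl I1 I3 S1 S3).
  pose proof (packing_opposite _ _ _ _ _ _ _ _ pkij Hl I1 I4 S1 S4).
  pose proof (packing_adjacent _ _ _ _ _ _ _ _ He0 pijk Hl I3 I2 S3 S2).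
  pose proof (packing_PP _ _ _ _ _ _ _ _ pjki Hl I2 I4 S2 S4).
  pose proof (packing_adjacent _ _ _ _ _ _ _ _ He0 pikj Hl I3 I4 S3 S4).
  finish_sectors.
Qed.

Lemma quint_MMMPP m e l i j k u0 u1 u2 u3 u4 : e = 0 \/ e = 1 -> 2 <= m ->
  perm i j k -> packing m e l ->
  In u0 l -> secM i u0 = true ->
  In u1 l -> secP k u1 = true ->
  In u2 l -> secM j u2 = true ->
  In u3 l -> secP i u3 = true ->
  In u4 l -> secM k u4 = true ->
  weight m e u0 + weight m e u1 + weight m e u2 + weight m e u3 + weight m e u4 <= 2 * (3 * m + 1).
Proof.
  intros He Hm Hp Hl I0 S0 I1 S1 I2 S2 I3 S3 I4 S4.
  start_sectors.
  pointM pijk I0 S0.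
  pointP pkij I1 S1.
  pointM pjik I2 S2.
  pointP pijk I3 S3.
  pointM pkij I4 S4.
  pose proof (packing_adjacent _ _ _ _ _ _ _ _ He0 pikj Hl I0 I1 S0 S1).
  pose proof (packing_MM _ _ _ _ _ _ _ _ pijk Hl I0 I2 S0 S2).
  pose proof (packing_opposite _ _ _ _ _ _ _ _ pijk Hl I0 I3 S0 S3).
  pose proof (packing_MM _ _ _ _ _ _ _ _ pikj Hl I0 I4 S0 S4).
  pose proof (packing_adjacent _ _ _ _ _ _ _ _ He0 pjki Hl I2 I1 S2 S1).
  pose proof (packing_PP _ _ _ _ _ _ _ _ pkij Hl I1 I3 S1 S3).
  pose proof (packing_opposite _ _ _ _ _ _ _ _ pkij Hl I4 I1 S4 S1).
  pose proof (packing_adjacent _ _ _ _ _ _ _ _ He0 pjik Hl I2 I3 S2 S3).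
  pose proof (packing_MM _ _ _ _ _ _ _ _ pjki Hl I2 I4 S2 S4).
  pose proof (packing_adjacent _ _ _ _ _ _ _ _ He0 pkij Hl I4 I3 S4 S3).
  finish_sectors.
Qed.

(* Summing the six adjacent pairs bounds the total norm below by about [12 p],
   while each of the six norms is less than [2 p]. *)
Lemma hexad_infeasible m e l i j k u0 u1 u2 v0 v1 v2 : e = 0 \/ e = 1 ->
  perm i j k -> packing m e l ->
  In u0 l -> secM i u0 = true -> In u1 l -> secM j u1 = true ->
  In u2 l -> secM k u2 = true -> In v0 l -> secP i v0 = true ->
  In v1 l -> secP j v1 = true -> In v2 l -> secP k v2 = true -> False.
Proof.
  intros He Hp Hl I0 S0 I1 S1 I2 S2 J0 T0 J1 T1 J2 T2.
  start_sectors.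
  pointM pijk I0 S0. pointM pjik I1 S1. pointM pkij I2 S2.
  pointP pijk J0 T0. pointP pjik J1 T1. pointP pkij J2 T2.
  pose proof (packing_adjacent _ _ _ _ _ _ _ _ He0 pijk Hl I0 J1 S0 T1).
  pose proof (packing_adjacent _ _ _ _ _ _ _ _ He0 pikj Hl I0 J2 S0 T2).
  pose proof (packing_adjacent _ _ _ _ _ _ _ _ He0 pjik Hl I1 J0 S1 T0).
  pose proof (packing_adjacent _ _ _ _ _ _ _ _ He0 pjki Hl I1 J2 S1 T2).
  pose proof (packing_adjacent _ _ _ _ _ _ _ _ He0 pkij Hl I2 J0 S2 T0).
  pose proof (packing_adjacent _ _ _ _ _ _ _ _ He0 pkji Hl I2 J1 S2 T1).
  lia.
Qed.

(** * Reduction of a packing to the set of sectors it occupies *)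

Definition zsum {A : Type} (f : A -> Z) (l : list A) : Z :=
  fold_right (fun x acc => f x + acc) 0 l.

Lemma zsum_app {A} (f : A -> Z) l1 l2 : zsum f (l1 ++ l2) = zsum f l1 + zsum f l2.
Proof. induction l1; simpl; lia. Qed.

Definition sectors : list (cube -> bool) :=
  [secM AX; secM AY; secM AZ; secP AX; secP AY; secP AZ].

(** Three positive coordinates would have sum at least 3, and three nonpositive ones force the
    origin, which the norm excludes; each remaining sign pattern is one sector. *)
Lemma outer_sector m e u : 0 <= e -> outer m e u ->
  zsum (fun s : cube -> bool => if s u then 1 else 0) sectors = 1.
Proof.
  intros He [Hg [Hn _]]; destruct u as [[a b] c].
  unfold cnorm, cgood, csum, cdist in *; simpl.
  destruct (Z.leb_spec a 0), (Z.leb_spec b 0), (Z.leb_spec c 0),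
    (Z.ltb_spec 0 a), (Z.ltb_spec 0 b), (Z.ltb_spec 0 c); simpl; lia.
Qed.

Lemma zsum_sectors m e (f : cube -> Z) l : 0 <= e -> (forall u, In u l -> outer m e u) ->
  zsum f l = zsum (fun s => zsum f (filter s l)) sectors.
Proof.
  intros He Ho; induction l as [|u l IH]; [reflexivity |].
  assert (IH' : zsum f l = zsum (fun s => zsum f (filter s l)) sectors)
    by (apply IH; intros; apply Ho; right; assumption).
  pose proof (outer_sector m e u He (Ho u (or_introl eq_refl))) as H1.
  simpl in *; rewrite IH'.
  destruct (secM AX u), (secM AY u), (secM AZ u), (secP AX u), (secP AY u), (secP AZ u);
    simpl in *; lia.
Qed.

(** Within one sector the distance of two points is at most the larger of their norms, hence at most
    [4 m + e - 1], which is less than [2 p]. *)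
Lemma same_sector m e s u v : 0 <= e <= 1 -> In s sectors -> outer m e u -> outer m e v ->
  s u = true -> s v = true -> ~ far m e u v.
Proof.
  intros He Hs [Gu [Nu _]] [Gv [Nv _]]; destruct u as [[a b] c], v as [[a' b'] c'].
  unfold far, cnorm, cgood, csum, cdist in *.
  intros Su Sv; repeat destruct Hs as [<- | Hs]; try contradiction;
    unfold secM, secP in *; bool_lia; lia.
Qed.

Lemma zsum_sector m e (f : cube -> Z) l s : 0 <= e <= 1 -> NoDup l -> packing m e l ->
  In s sectors ->
  zsum f (filter s l) = 0 \/ exists u, In u l /\ s u = true /\ zsum f (filter s l) = f u.
Proof.
  intros He Hd [Ho Hf] Hs.
  assert (Hin : forall u, In u (filter s l) -> In u l /\ s u = true)
    by (intros u; apply filter_In).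
  pose proof (NoDup_filter s Hd) as Hd'.
  destruct (filter s l) as [|u [|v r]]; [left; reflexivity | right | exfalso].
  - exists u; destruct (Hin u (or_introl eq_refl)); simpl; intuition lia.
  - destruct (Hin u) as [Iu Su]; [left; reflexivity |].
    destruct (Hin v) as [Iv Sv]; [right; left; reflexivity |].
    apply (same_sector m e s u v); auto.
    apply Hf; auto.
    inversion Hd'; subst; intros ->; simpl in *; tauto.
Qed.

(** The patterns go from five occupied sectors down to two: a larger set of points also matches the
    smaller patterns, whose bound does not cover the whole sum. *)
Ltac apply_sector_lemma He Hm Hl :=
  match goal with
  | Hp : perm ?i ?j ?k, S0 : secP ?i ?u0 = true, I0 : In ?u0 _,
      S1 : secM ?k ?u1 = true, I1 : In ?u1 _, S2 : secP ?j ?u2 = true, I2 : In ?u2 _,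
      S3 : secM ?i ?u3 = true, I3 : In ?u3 _, S4 : secP ?k ?u4 = true, I4 : In ?u4 _ |- _ =>
      pose proof (quint_MMPPP _ _ _ i j k u0 u1 u2 u3 u4 He Hm Hp Hl I0 S0 I1 S1 I2 S2 I3 S3 I4 S4);
      lia
  | Hp : perm ?i ?j ?k, S0 : secM ?i ?u0 = true, I0 : In ?u0 _,
      S1 : secP ?k ?u1 = true, I1 : In ?u1 _, S2 : secM ?j ?u2 = true, I2 : In ?u2 _,
      S3 : secP ?i ?u3 = true, I3 : In ?u3 _, S4 : secM ?k ?u4 = true, I4 : In ?u4 _ |- _ =>
      pose proof (quint_MMMPP _ _ _ i j k u0 u1 u2 u3 u4 He Hm Hp Hl I0 S0 I1 S1 I2 S2 I3 S3 I4 S4);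
      lia
  | Hp : perm ?i ?j ?k, S0 : secM ?i ?u0 = true, I0 : In ?u0 _,
      S1 : secP ?i ?u1 = true, I1 : In ?u1 _, S2 : secP ?j ?u2 = true, I2 : In ?u2 _,
      S3 : secP ?k ?u3 = true, I3 : In ?u3 _ |- _ =>
      pose proof (quad_MPPP _ _ _ i j k u0 u1 u2 u3 He Hm Hp Hl I0 S0 I1 S1 I2 S2 I3 S3); lia
  | Hp : perm ?i ?j ?k, S0 : secM ?i ?u0 = true, I0 : In ?u0 _,
      S1 : secM ?j ?u1 = true, I1 : In ?u1 _, S2 : secM ?k ?u2 = true, I2 : In ?u2 _,
      S3 : secP ?i ?u3 = true, I3 : In ?u3 _ |- _ =>
      pose proof (quad_MMMP _ _ _ i j k u0 u1 u2 u3 He Hm Hp Hl I0 S0 I1 S1 I2 S2 I3 S3); lia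
  | Hp : perm ?i ?j ?k, S0 : secM ?i ?u0 = true, I0 : In ?u0 _,
      S1 : secM ?j ?u1 = true, I1 : In ?u1 _, S2 : secP ?i ?u2 = true, I2 : In ?u2 _,
      S3 : secP ?j ?u3 = true, I3 : In ?u3 _ |- _ =>
      pose proof (quad_MMPP _ _ _ i j k u0 u1 u2 u3 He Hm Hp Hl I0 S0 I1 S1 I2 S2 I3 S3); lia
  | Hp : perm ?i ?j ?k, S0 : secM ?i ?u0 = true, I0 : In ?u0 _,
      S1 : secM ?j ?u1 = true, I1 : In ?u1 _, S2 : secP ?i ?u2 = true, I2 : In ?u2 _,
      S3 : secP ?k ?u3 = true, I3 : In ?u3 _ |- _ =>
      pose proof (quad_MMPP_adj _ _ _ i j k u0 u1 u2 u3 He Hm Hp Hl I0 S0 I1 S1 I2 S2 I3 S3); lia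
  | Hp : perm ?i ?j ?k, S0 : secM ?i ?u0 = true, I0 : In ?u0 _,
      S1 : secM ?j ?u1 = true, I1 : In ?u1 _, S2 : secM ?k ?u2 = true, I2 : In ?u2 _ |- _ =>
      pose proof (triple_MMM _ _ _ i j k u0 u1 u2 He Hm Hp Hl I0 S0 I1 S1 I2 S2); lia
  | Hp : perm ?i ?j ?k, S0 : secP ?i ?u0 = true, I0 : In ?u0 _,
      S1 : secP ?j ?u1 = true, I1 : In ?u1 _, S2 : secP ?k ?u2 = true, I2 : In ?u2 _ |- _ =>
      pose proof (triple_PPP _ _ _ i j k u0 u1 u2 He Hm Hp Hl I0 S0 I1 S1 I2 S2); lia
  | Hp : perm ?i ?j ?k, S0 : secM ?i ?u0 = true, I0 : In ?u0 _,
      S1 : secP ?i ?u1 = true, I1 : In ?u1 _, S2 : secP ?j ?u2 = true, I2 : In ?u2 _ |- _ =>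
      pose proof (triple_MPP _ _ _ i j k u0 u1 u2 He Hm Hp Hl I0 S0 I1 S1 I2 S2); lia
  | Hp : perm ?i ?j ?k, S0 : secM ?i ?u0 = true, I0 : In ?u0 _,
      S1 : secM ?j ?u1 = true, I1 : In ?u1 _, S2 : secP ?i ?u2 = true, I2 : In ?u2 _ |- _ =>
      pose proof (triple_MMP _ _ _ i j k u0 u1 u2 He Hm Hp Hl I0 S0 I1 S1 I2 S2); lia
  | Hp : perm ?i ?j ?k, S0 : secM ?i ?u0 = true, I0 : In ?u0 _,
      S1 : secP ?j ?u1 = true, I1 : In ?u1 _, S2 : secP ?k ?u2 = true, I2 : In ?u2 _ |- _ =>
      pose proof (triple_MPP_adj _ _ _ i j k u0 u1 u2 He Hm Hp Hl I0 S0 I1 S1 I2 S2); lia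
  | Hp : perm ?i ?j ?k, S0 : secM ?i ?u0 = true, I0 : In ?u0 _,
      S1 : secM ?j ?u1 = true, I1 : In ?u1 _, S2 : secP ?k ?u2 = true, I2 : In ?u2 _ |- _ =>
      pose proof (triple_MMP_adj _ _ _ i j k u0 u1 u2 He Hm Hp Hl I0 S0 I1 S1 I2 S2); lia
  | Hp : perm ?i ?j ?k, S0 : secM ?i ?u0 = true, I0 : In ?u0 _,
      S1 : secP ?i ?u1 = true, I1 : In ?u1 _ |- _ =>
      pose proof (pair_MP _ _ _ i j k u0 u1 He Hm Hp Hl I0 S0 I1 S1); lia
  | Hp : perm ?i ?j ?k, S0 : secM ?i ?u0 = true, I0 : In ?u0 _,
      S1 : secP ?j ?u1 = true, I1 : In ?u1 _ |- _ =>
      pose proof (pair_MP_adj _ _ _ i j k u0 u1 He Hm Hp Hl I0 S0 I1 S1); lia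
  | Hp : perm ?i ?j ?k, S0 : secM ?i ?u0 = true, I0 : In ?u0 _,
      S1 : secM ?j ?u1 = true, I1 : In ?u1 _ |- _ =>
      pose proof (pair_MM _ _ _ i j k u0 u1 He Hm Hp Hl I0 S0 I1 S1); lia
  | Hp : perm ?i ?j ?k, S0 : secP ?i ?u0 = true, I0 : In ?u0 _,
      S1 : secP ?j ?u1 = true, I1 : In ?u1 _ |- _ =>
      pose proof (pair_PP _ _ _ i j k u0 u1 He Hm Hp Hl I0 S0 I1 S1); lia
  end.

Lemma packing_weight m e l : e = 0 \/ e = 1 -> 2 <= m -> NoDup l -> packing m e l ->
  zsum (weight m e) l <= 2 * (3 * m + 1).
Proof.
  intros He Hm Hd Hl.
  assert (He' : 0 <= e <= 1) by lia.
  assert (Hle : forall u, In u l -> weight m e u <= 2 * (3 * m + 1)).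
  { intros u Hu; destruct (proj1 Hl u Hu) as [Hg [Hn Hw]].
    rewrite (outer_weight m e u (proj1 Hl u Hu)).
    destruct u as [[a b] c]; unfold range, cnorm, cdist, cgood, csum in *; clear Hw.
    destruct (middle _ && _); lia. }
  rewrite (zsum_sectors m e) by (try lia; apply Hl).
  assert (HS : forall s, In s sectors -> zsum (weight m e) (filter s l) = 0 \/
     exists u, In u l /\ s u = true /\ zsum (weight m e) (filter s l) = weight m e u)
    by (intros; apply (zsum_sector m e); assumption).
  assert (PXYZ : perm AX AY AZ) by (unfold perm; repeat split; discriminate).
  destruct (perm_all _ _ _ PXYZ) as (PXZY & PYXZ & PYZX & PZXY & PZYX).
  pose proof (HS (secM AX)) as H0; pose proof (HS (secM AY)) as H1; pose proof (HS (secM AZ)) as H2.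
  pose proof (HS (secP AX)) as H3; pose proof (HS (secP AY)) as H4; pose proof (HS (secP AZ)) as H5.
  clear HS; unfold zsum at 1; cbn [sectors fold_right In] in *.
  (* Each sector is empty or holds one point, which makes 64 cases: six points are impossible, two
     to five are covered by the preceding lemmas, one by [Hle], and none is trivial. *)
  destruct H0 as [-> | (u0 & I0 & S0 & ->)]; [tauto | |];
  (destruct H1 as [-> | (u1 & I1 & S1 & ->)]; [tauto | |]);
  (destruct H2 as [-> | (u2 & I2 & S2 & ->)]; [tauto | |]);
  (destruct H3 as [-> | (u3 & I3 & S3 & ->)]; [tauto | |]);
  (destruct H4 as [-> | (u4 & I4 & S4 & ->)]; [tauto | |]);
  (destruct H5 as [-> | (u5 & I5 & S5 & ->)]; [tauto | |]);
  first [ exfalso; exact (hexad_infeasible m e l AX AY AZ u0 u1 u2 u3 u4 u5 He PXYZ Hl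
                            I0 S0 I1 S1 I2 S2 I3 S3 I4 S4 I5 S5)
        | apply_sector_lemma He Hm Hl
        | match goal with I : In ?u l |- _ => specialize (Hle u I); lia end
        | lia ].
Qed.

(** * Sums over boxes *)

Lemma zsum_ext {A} (f g : A -> Z) l : (forall x, In x l -> f x = g x) -> zsum f l = zsum g l.
Proof. intros H; induction l; simpl in *; [reflexivity | rewrite IHl, H; auto]. Qed.

Lemma zsum_le {A} (f g : A -> Z) l : (forall x, In x l -> f x <= g x) -> zsum f l <= zsum g l.
Proof.
  intros H; induction l as [|x l IH]; simpl; [lia |].
  pose proof (H x (or_introl eq_refl)).
  assert (zsum f l <= zsum g l) by (apply IH; intros; apply H; right; assumption); lia.
Qed.

Lemma zsum_map {A B} (h : A -> B) (f : B -> Z) l : zsum f (map h l) = zsum (fun x => f (h x)) l.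
Proof. induction l; simpl; lia. Qed.

Definition upto (M : nat) : list Z := map Z.of_nat (seq 0 M).

Definition box (M : nat) : list (Z * Z) := list_prod (upto M) (upto M).

Lemma in_upto M a : In a (upto M) <-> 0 <= a < Z.of_nat M.
Proof.
  unfold upto; rewrite in_map_iff; split.
  - intros [k [<- Hk]]; apply in_seq in Hk; lia.
  - intros H; exists (Z.to_nat a); split; [lia | apply in_seq; lia].
Qed.

Lemma in_box M q : In q (box M) <-> 0 <= fst q < Z.of_nat M /\ 0 <= snd q < Z.of_nat M.
Proof. destruct q; unfold box; rewrite in_prod_iff, !in_upto; reflexivity. Qed.

Definition rsum (M : nat) (f : Z -> Z) : Z := zsum f (upto M).

Definition bsum (M : nat) (g : Z -> Z -> Z) : Z := zsum (fun q => g (fst q) (snd q)) (box M).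

Lemma rsum_S M f : rsum (S M) f = f 0 + rsum M (fun a => f (a + 1)).
Proof.
  unfold rsum, upto; simpl; f_equal.
  rewrite <- seq_shift, map_map, !zsum_map.
  apply zsum_ext; intros; f_equal; lia.
Qed.

Lemma rsum_ext M f g : (forall a, 0 <= a -> f a = g a) -> rsum M f = rsum M g.
Proof. intros H; apply zsum_ext; intros a Ha; apply in_upto in Ha; apply H; lia. Qed.

Lemma rsum_le M f g : (forall a, 0 <= a -> f a <= g a) -> rsum M f <= rsum M g.
Proof. intros H; apply zsum_le; intros a Ha; apply in_upto in Ha; apply H; lia. Qed.

Lemma rsum_0 M : rsum M (fun _ => 0) = 0.
Proof. unfold rsum; induction (upto M); simpl; lia. Qed.

Lemma rsum_add M f g : rsum M (fun a => f a + g a) = rsum M f + rsum M g.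
Proof. unfold rsum; induction (upto M); simpl; lia. Qed.

Lemma bsum_rsum M g : bsum M g = rsum M (fun b => rsum M (g b)).
Proof.
  assert (H : forall l, zsum (fun q => g (fst q) (snd q)) (list_prod l (upto M)) =
                        zsum (fun b => zsum (g b) (upto M)) l).
  { induction l as [|a l IH]; [reflexivity |].
    simpl; rewrite zsum_app, IH, zsum_map; reflexivity. }
  apply H.
Qed.

Lemma bsum_ext M g h : (forall b c, 0 <= b -> 0 <= c -> g b c = h b c) -> bsum M g = bsum M h.
Proof. intros H; apply zsum_ext; intros q Hq; apply in_box in Hq; apply H; lia. Qed.

Lemma bsum_le M g h : (forall b c, 0 <= b -> 0 <= c -> g b c <= h b c) -> bsum M g <= bsum M h.
Proof. intros H; apply zsum_le; intros q Hq; apply in_box in Hq; apply H; lia. Qed.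

Lemma bsum_0 M : bsum M (fun _ _ => 0) = 0.
Proof. unfold bsum; induction (box M); simpl; lia. Qed.

Lemma bsum_S M g : bsum (S M) g =
  g 0 0 + rsum M (fun c => g 0 (c + 1)) + rsum M (fun b => g (b + 1) 0)
  + bsum M (fun b c => g (b + 1) (c + 1)).
Proof.
  rewrite !bsum_rsum, !rsum_S.
  rewrite (rsum_ext M (fun b => rsum (S M) (g (b + 1)))
    (fun b => g (b + 1) 0 + rsum M (fun c => g (b + 1) (c + 1))))
    by (intros; apply rsum_S).
  rewrite (rsum_add M (fun b => g (b + 1) 0)); lia.
Qed.

(** Only an upper bound, since [M] may cut the interval off. This suffices here and in
    [bsum_diagonal] and [bsum_triangle], because these counts enter the total weight with a negative
    sign. *)
Lemma rsum_interval M lo hi : lo <= hi ->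
  rsum M (fun a => if (lo <=? a) && (a <? hi) then 1 else 0) <= hi - lo.
Proof.
  revert lo hi; induction M as [|M IH]; intros lo hi H; [unfold rsum; simpl; lia |].
  rewrite rsum_S.
  destruct (Z_lt_le_dec 0 hi) as [Hh | Hh].
  - rewrite (rsum_ext M _ (fun a => if (lo - 1 <=? a) && (a <? hi - 1) then 1 else 0)).
    + destruct (Z.leb_spec lo 0), (Z.ltb_spec 0 hi); cbn [andb]; try lia.
      * rewrite (rsum_ext M _ (fun a => if (0 <=? a) && (a <? hi - 1) then 1 else 0)).
        -- specialize (IH 0 (hi - 1)); lia.
        -- intros a Ha; destruct (Z.leb_spec 0 a), (Z.leb_spec (lo - 1) a); reflexivity || lia.
      * specialize (IH (lo - 1) (hi - 1)); lia.
    + intros a Ha; destruct (Z.leb_spec lo (a + 1)), (Z.ltb_spec (a + 1) hi),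
        (Z.leb_spec (lo - 1) a), (Z.ltb_spec a (hi - 1)); reflexivity || lia.
  - rewrite (rsum_ext M _ (fun _ => 0)), rsum_0.
    + destruct (Z.leb_spec lo 0), (Z.ltb_spec 0 hi); cbn [andb]; lia.
    + intros a Ha; destruct (Z.ltb_spec (a + 1) hi); [lia | now rewrite andb_false_r].
Qed.

Lemma bsum_diagonal M t lo hi : lo <= hi ->
  bsum M (fun b c => if (c =? b + t) && ((lo <=? b) && (b <? hi)) then 1 else 0) <= hi - lo.
Proof.
  intros H; rewrite bsum_rsum.
  transitivity (rsum M (fun a => if (lo <=? a) && (a <? hi) then 1 else 0));
    [| apply rsum_interval; exact H].
  apply rsum_le; intros b Hb.
  destruct ((lo <=? b) && (b <? hi)).
  - rewrite (rsum_ext M _ (fun c => if (b + t <=? c) && (c <? b + t + 1) then 1 else 0)).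
    + pose proof (rsum_interval M (b + t) (b + t + 1)); lia.
    + intros c Hc; destruct (Z.eqb_spec c (b + t)), (Z.leb_spec (b + t) c),
        (Z.ltb_spec c (b + t + 1)); reflexivity || lia.
  - rewrite (rsum_ext M _ (fun _ => 0)), rsum_0; [lia |].
    intros; now rewrite andb_false_r.
Qed.

Lemma bsum_corner M : bsum (S M) (fun b c => if (b =? 0) && (c =? 0) then 1 else 0) = 1.
Proof.
  rewrite bsum_S; simpl.
  rewrite (rsum_ext M _ (fun _ => 0)), rsum_0.
  - rewrite (rsum_ext M _ (fun _ => 0)), rsum_0.
    + rewrite (bsum_ext M _ (fun _ _ => 0)), bsum_0; [reflexivity |].
      intros b c Hb Hc; destruct (Z.eqb_spec (b + 1) 0); [lia | reflexivity].
    + intros b Hb; destruct (Z.eqb_spec (b + 1) 0); [lia | reflexivity].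
  - intros c Hc; destruct (Z.eqb_spec (c + 1) 0); [lia | reflexivity].
Qed.

(** Peeling the two sides through the origin turns [k] into [k - 2]. The recursion ends at -1 or -2,
    where the right-hand side vanishes. *)
Lemma bsum_triangle M k : -2 <= k ->
  2 * bsum M (fun b c => if b + c <=? k then 1 else 0) <= (k + 1) * (k + 2).
Proof.
  revert k; induction M as [|M IH]; intros k Hk; [unfold bsum; simpl; nia |].
  destruct (Z_lt_le_dec k 0) as [Hn | Hn].
  - rewrite (bsum_ext _ _ (fun _ _ => 0)), bsum_0; [nia |].
    intros b c Hb Hc; destruct (Z.leb_spec (b + c) k); lia.
  - rewrite bsum_S.
    rewrite (bsum_ext M _ (fun b c => if b + c <=? k - 2 then 1 else 0)).
    + assert (H : rsum M (fun c => if 0 + (c + 1) <=? k then 1 else 0) <= k).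
      { rewrite (rsum_ext M _ (fun c => if (0 <=? c) && (c <? k) then 1 else 0)).
        - pose proof (rsum_interval M 0 k); lia.
        - intros c Hc; destruct (Z.leb_spec (0 + (c + 1)) k), (Z.leb_spec 0 c),
            (Z.ltb_spec c k); reflexivity || lia. }
      rewrite (rsum_ext M (fun b => if b + 1 + 0 <=? k then 1 else 0)
                 (fun c => if 0 + (c + 1) <=? k then 1 else 0))
        by (intros b Hb; replace (0 + (b + 1)) with (b + 1 + 0) by lia; reflexivity).
      specialize (IH (k - 2)).
      destruct (0 + 0 <=? k); nia.
    + intros b c Hb Hc; destruct (Z.leb_spec (b + 1 + (c + 1)) k),
        (Z.leb_spec (b + c) (k - 2)); reflexivity || lia.
Qed.

(** * Closed forms for sums of tents *)

Definition ramp (M : nat) (j : Z) : Z := rsum M (fun c => Z.max 0 (j - 2 * c)).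

Lemma ramp_S M j : ramp (S M) j = Z.max 0 j + ramp M (j - 2).
Proof.
  unfold ramp; rewrite rsum_S; f_equal; [lia |].
  apply rsum_ext; intros; lia.
Qed.

Lemma ramp_neg M j : j <= 0 -> ramp M j = 0.
Proof. intros H; unfold ramp; rewrite (rsum_ext M _ (fun _ => 0)), rsum_0; intros; lia. Qed.

(** The positive terms of the two ramps interleave to [j + (j - 1) + ... + 1]; the condition
    [j <= 2 M] ensures that none of them is cut off. *)
Lemma ramp_pair M j : 0 <= j <= 2 * Z.of_nat M -> 2 * (ramp M j + ramp M (j - 1)) = j * (j + 1).
Proof.
  revert j; induction M as [|M IH]; intros j Hj.
  - replace j with 0 by lia; reflexivity.
  - rewrite !ramp_S.
    destruct (Z_lt_le_dec j 2) as [H | H].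
    + rewrite !ramp_neg by lia; nia.
    + specialize (IH (j - 2)); replace (j - 1 - 2) with (j - 2 - 1) by lia; nia.
Qed.

Lemma ramp_S_pair M j : 0 <= j <= 2 * Z.of_nat M + 1 ->
  2 * (ramp (S M) j + ramp M (j - 1)) = j * (j + 1).
Proof.
  intros Hj; rewrite ramp_S.
  destruct (Z_lt_le_dec j 1) as [H | H].
  - rewrite !ramp_neg by lia; nia.
  - pose proof (ramp_pair M (j - 1)); replace (j - 2) with (j - 1 - 1) by lia; nia.
Qed.

(** Half the uncorrected weight of a sextant of left vertices. [tent'] is its counterpart for right
    vertices, where [b] starts at 1 so that rotated copies do not share a boundary ray. *)
Definition tent (M : nat) (j : Z) : Z := bsum M (fun b c => Z.max 0 (j - (b + c) - Z.max b c)).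

Definition tent' (M : nat) (j : Z) : Z :=
  bsum M (fun b c => Z.max 0 (j - (b + 1 + c) - Z.max (b + 1) c)).

(* Peeling off the two sides of the box through the origin shifts the tent by the diagonal step
   [(1, 1)], on which it drops by 3; in [tent'_S] and in the sum of two consecutive tents the
   ramps pair up, and the parity-dependent terms cancel. *)
Lemma tent_S M j : tent (S M) j = Z.max 0 j + 2 * ramp M (j - 2) + tent M (j - 3).
Proof.
  unfold tent; rewrite bsum_S; unfold ramp.
  rewrite (rsum_ext M (fun c => Z.max 0 (j - (0 + (c + 1)) - Z.max 0 (c + 1)))
    (fun c => Z.max 0 (j - 2 - 2 * c))) by (intros; lia).
  rewrite (rsum_ext M (fun b => Z.max 0 (j - (b + 1 + 0) - Z.max (b + 1) 0))
    (fun c => Z.max 0 (j - 2 - 2 * c))) by (intros; lia).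
  rewrite (bsum_ext M _ (fun b c => Z.max 0 (j - 3 - (b + c) - Z.max b c))) by (intros; lia).
  lia.
Qed.

Lemma tent'_S M j : tent' (S M) j = ramp (S M) (j - 2) + ramp M (j - 3) + tent' M (j - 3).
Proof.
  unfold tent'; rewrite bsum_S, ramp_S; unfold ramp.
  rewrite (rsum_ext M (fun c => Z.max 0 (j - (0 + 1 + (c + 1)) - Z.max (0 + 1) (c + 1)))
    (fun c => Z.max 0 (j - 3 - 2 * c))) by (intros; lia).
  rewrite (rsum_ext M (fun b => Z.max 0 (j - (b + 1 + 1 + 0) - Z.max (b + 1 + 1) 0))
    (fun c => Z.max 0 (j - 2 - 2 - 2 * c))) by (intros; lia).
  rewrite (bsum_ext M _ (fun b c => Z.max 0 (j - 3 - (b + 1 + c) - Z.max (b + 1) c)))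
    by (intros; lia).
  lia.
Qed.

Lemma tent_neg M j : j <= 0 -> tent M j = 0.
Proof. intros H; unfold tent; rewrite (bsum_ext M _ (fun _ _ => 0)), bsum_0; intros; lia. Qed.

Lemma tent'_neg M j : j <= 2 -> tent' M j = 0.
Proof. intros H; unfold tent'; rewrite (bsum_ext M _ (fun _ _ => 0)), bsum_0; intros; lia. Qed.

Lemma tent'_eq (m M : nat) e : e = 0 \/ e = 1 -> (2 * m <= M)%nat ->
  2 * tent' M (3 * Z.of_nat m + 1 + e) = 3 * Z.of_nat m * (Z.of_nat m + 1) * (Z.of_nat m + e).
Proof.
  intros He; revert M; induction m as [|m IH]; intros M HM.
  - rewrite tent'_neg by lia; lia.
  - destruct M as [|M]; [lia |].
    rewrite tent'_S.
    pose proof (ramp_S_pair M (3 * Z.of_nat (S m) + 1 + e - 2)).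
    replace (3 * Z.of_nat (S m) + 1 + e - 2 - 1) with (3 * Z.of_nat (S m) + 1 + e - 3) in H by lia.
    specialize (IH M).
    replace (3 * Z.of_nat (S m) + 1 + e - 3) with (3 * Z.of_nat m + 1 + e) in * by lia.
    rewrite Z.mul_add_distr_l, H, IH by lia.
    destruct He as [-> | ->]; lia.
Qed.

Lemma tent_pair_eq (m M : nat) e : e = 0 \/ e = 1 -> (2 * m + 1 <= M)%nat ->
  tent M (3 * Z.of_nat m + e) + tent M (3 * Z.of_nat m + e - 1) =
  3 * Z.of_nat m * (Z.of_nat m + 1) * (Z.of_nat m + e) + Z.of_nat m + e.
Proof.
  intros He; revert M; induction m as [|m IH]; intros M HM.
  - destruct M as [|M]; [lia |].
    rewrite !tent_S, !ramp_neg, !tent_neg by lia; lia.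
  - destruct M as [|M]; [lia |].
    rewrite !tent_S.
    pose proof (ramp_pair M (3 * Z.of_nat (S m) + e - 2)).
    specialize (IH M).
    replace (3 * Z.of_nat (S m) + e - 2 - 1) with (3 * Z.of_nat (S m) + e - 1 - 2) in H by lia.
    replace (3 * Z.of_nat (S m) + e - 3) with (3 * Z.of_nat m + e) in * by lia.
    replace (3 * Z.of_nat (S m) + e - 1 - 3) with (3 * Z.of_nat m + e - 1) in * by lia.
    destruct He as [-> | ->]; lia.
Qed.

(** * Total weight *)

Definition rot (u : cube) : cube := let '(a, b, c) := u in (c, a, b).

(* Up to rotation every nonzero vertex is in exactly one of these: right vertices ([R]) and left
   vertices ([L]) with two nonnegative ([1]) or two nonpositive ([2]) parameters. *)
Definition sextantR1 (q : Z * Z) : cube := let '(b, c) := q in (- (b + 1 + c), b + 1, c).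
Definition sextantR2 (q : Z * Z) : cube := let '(b, c) := q in (b + 1 + c, - (b + 1), - c).
Definition sextantL1 (q : Z * Z) : cube := let '(b, c) := q in (- (b + c + 1), b + 1, c + 1).
Definition sextantL2 (q : Z * Z) : cube := let '(b, c) := q in (b + c + 1, - b, - c).

Lemma cnorm_sextantR1 b c : 0 <= b -> 0 <= c -> cnorm (sextantR1 (b, c)) = 2 * (b + 1 + c).
Proof. unfold cnorm, sextantR1, cdist; lia. Qed.
Lemma cnorm_sextantR2 b c : 0 <= b -> 0 <= c -> cnorm (sextantR2 (b, c)) = 2 * (b + 1 + c).
Proof. unfold cnorm, sextantR2, cdist; lia. Qed.
Lemma cnorm_sextantL1 b c : 0 <= b -> 0 <= c -> cnorm (sextantL1 (b, c)) = 2 * (b + c) + 3.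
Proof. unfold cnorm, sextantL1, cdist; lia. Qed.
Lemma cnorm_sextantL2 b c : 0 <= b -> 0 <= c -> cnorm (sextantL2 (b, c)) = 2 * (b + c) + 1.
Proof. unfold cnorm, sextantL2, cdist; lia. Qed.

Lemma range_sextantR1 b c : 0 <= b -> 0 <= c ->
  range (sextantR1 (b, c)) = b + 1 + c + Z.max (b + 1) c.
Proof. unfold range, sextantR1; lia. Qed.
Lemma range_sextantR2 b c : 0 <= b -> 0 <= c ->
  range (sextantR2 (b, c)) = b + 1 + c + Z.max (b + 1) c.
Proof. unfold range, sextantR2; lia. Qed.
Lemma range_sextantL1 b c : 0 <= b -> 0 <= c -> range (sextantL1 (b, c)) = b + c + 2 + Z.max b c.
Proof. unfold range, sextantL1; lia. Qed.
Lemma range_sextantL2 b c : 0 <= b -> 0 <= c -> range (sextantL2 (b, c)) = b + c + 1 + Z.max b c.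
Proof. unfold range, sextantL2; lia. Qed.

Ltac middle_cases :=
  unfold middle, csum;
  repeat match goal with
  | |- context [?x =? ?y] => destruct (Z.eqb_spec x y)
  | |- context [?x <? ?y] => destruct (Z.ltb_spec x y)
  end; cbn [andb orb]; reflexivity || lia.

Lemma middle_sextantR1 b c : 0 <= b -> 0 <= c -> middle (sextantR1 (b, c)) = false.
Proof. intros; unfold sextantR1; middle_cases. Qed.
Lemma middle_sextantR2 b c : 0 <= b -> 0 <= c -> middle (sextantR2 (b, c)) = (c =? b + 1).
Proof. intros; unfold sextantR2; middle_cases. Qed.
Lemma middle_sextantL1 b c : 0 <= b -> 0 <= c -> middle (sextantL1 (b, c)) = (c =? b).
Proof. intros; unfold sextantL1; middle_cases. Qed.
Lemma middle_sextantL2 b c : 0 <= b -> 0 <= c -> middle (sextantL2 (b, c)) = false.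
Proof. intros; unfold sextantL2; middle_cases. Qed.

(** Each vertex of the ball of radius [p] is charged the weight of one full colour class, so the sum
    of [excess] compares the total weight with the size of the ball. *)
Definition excess (m e : Z) (u : cube) : Z :=
  weight m e u - 2 * (3 * m + 1) * (if cnorm u <=? 2 * m + e then 1 else 0).

Ltac if_cases :=
  repeat match goal with
  | |- context [?x =? ?y] => destruct (Z.eqb_spec x y); try (exfalso; lia)
  | |- context [?x <=? ?y] => destruct (Z.leb_spec x y); try (exfalso; lia)
  | |- context [?x <? ?y] => destruct (Z.ltb_spec x y); try (exfalso; lia)
  end; cbn [andb]; lia.

(** The terms in order: the tent, the gain from the full class next to the origin, the loss at the
    point cut off by the norm bound [4 m + e - 1], and the charge for the ball. The cut-off point is
    written as an interval of length 1 on a diagonal so that [bsum_diagonal] counts it. The other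
    sextants follow the same scheme, with a further diagonal term for middle vertices in
    [excess_sextantR2] and [excess_sextantL1]. *)
Lemma excess_sextantR1 m e b c : e = 0 \/ e = 1 -> 2 <= m -> 0 <= b -> 0 <= c ->
  2 * Z.max 0 (3 * m + 1 + e - (b + 1 + c) - Z.max (b + 1) c)
  + 2 * e * (if (b =? 0) && (c =? 0) then 1 else 0)
  - 2 * (1 - e) * (if (c =? b + 1) && ((m - 1 <=? b) && (b <? m)) then 1 else 0)
  - 2 * (3 * m + 1) * (if b + c <=? m - 1 then 1 else 0) <= excess m e (sextantR1 (b, c)).
Proof.
  intros He Hm Hb Hc; unfold excess, weight.
  rewrite middle_sextantR1, cnorm_sextantR1, range_sextantR1 by assumption.
  destruct He as [-> | ->]; if_cases.
Qed.

Lemma excess_sextantR2 m e b c : e = 0 \/ e = 1 -> 2 <= m -> 0 <= b -> 0 <= c ->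
  2 * Z.max 0 (3 * m + 1 + e - (b + 1 + c) - Z.max (b + 1) c)
  + 2 * e * (if (b =? 0) && (c =? 0) then 1 else 0)
  - 2 * (1 - e) * (if (c =? b + 1) && ((m - 1 <=? b) && (b <? m)) then 1 else 0)
  - (1 + e) * (if (c =? b + 1) && ((m / 2 <=? b) && (b <? m - 1 + e)) then 1 else 0)
  - 2 * (3 * m + 1) * (if b + c <=? m - 1 then 1 else 0) <= excess m e (sextantR2 (b, c)).
Proof.
  intros He Hm Hb Hc; unfold excess, weight.
  rewrite middle_sextantR2, cnorm_sextantR2, range_sextantR2 by assumption.
  assert (Hh : 2 * (m / 2) <= m < 2 * (m / 2) + 2) by (Z.to_euclidean_division_equations; lia).
  generalize dependent (m / 2); intros h Hh.
  destruct He as [-> | ->]; if_cases.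
Qed.

Lemma excess_sextantL1 m e b c : e = 0 \/ e = 1 -> 2 <= m -> 0 <= b -> 0 <= c ->
  2 * Z.max 0 (3 * m + e - 1 - (b + c) - Z.max b c)
  - 2 * e * (if (c =? b + - 1) && ((m <=? b) && (b <? m + 1)) then 1 else 0)
  - 2 * e * (if (c =? b + 1) && ((m - 1 <=? b) && (b <? m)) then 1 else 0)
  - (1 + e) * (if (c =? b + 0) && ((m - m / 2 <=? b) && (b <? m)) then 1 else 0)
  - 2 * (3 * m + 1) * (if b + c <=? m - 2 + e then 1 else 0) <= excess m e (sextantL1 (b, c)).
Proof.
  intros He Hm Hb Hc; unfold excess, weight.
  rewrite middle_sextantL1, cnorm_sextantL1, range_sextantL1 by assumption.
  assert (Hh : 2 * (m / 2) <= m < 2 * (m / 2) + 2) by (Z.to_euclidean_division_equations; lia).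
  generalize dependent (m / 2); intros h Hh.
  destruct He as [-> | ->]; if_cases.
Qed.

Lemma excess_sextantL2 m e b c : e = 0 \/ e = 1 -> 2 <= m -> 0 <= b -> 0 <= c ->
  2 * Z.max 0 (3 * m + e - (b + c) - Z.max b c)
  + 2 * (1 - e) * (if (b =? 0) && (c =? 0) then 1 else 0)
  - 2 * e * (if (c =? b + 0) && ((m <=? b) && (b <? m + 1)) then 1 else 0)
  - 2 * (3 * m + 1) * (if b + c <=? m - 1 + e then 1 else 0) <= excess m e (sextantL2 (b, c)).
Proof.
  intros He Hm Hb Hc; unfold excess, weight.
  rewrite middle_sextantL2, cnorm_sextantL2, range_sextantL2 by assumption.
  destruct He as [-> | ->]; if_cases.
Qed.

Lemma zsum_cons {A} (f : A -> Z) x l : zsum f (x :: l) = f x + zsum f l.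
Proof. reflexivity. Qed.

Lemma bsum_add M g h s :
  bsum M (fun b c => g b c + s * h b c) = bsum M g + s * bsum M h.
Proof. unfold bsum; induction (box M); simpl; lia. Qed.

Lemma bsum_sub M g h s :
  bsum M (fun b c => g b c - s * h b c) = bsum M g - s * bsum M h.
Proof. unfold bsum; induction (box M); simpl; lia. Qed.

Lemma bsum_scale M g s : bsum M (fun b c => s * g b c) = s * bsum M g.
Proof. unfold bsum; induction (box M); simpl; lia. Qed.

Definition third (M : nat) : list cube :=
  map sextantR1 (box M) ++ map sextantR2 (box M) ++ map sextantL1 (box M) ++ map sextantL2 (box M).

Definition region (M : nat) : list cube :=
  (0, 0, 0) :: third M ++ map rot (third M) ++ map rot (map rot (third M)).

Lemma cnorm_rot u : cnorm (rot u) = cnorm u.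
Proof. destruct u as [[a b] c]; unfold cnorm, cdist, rot; lia. Qed.

Lemma range_rot u : range (rot u) = range u.
Proof. destruct u as [[a b] c]; unfold range, rot; lia. Qed.

Lemma middle_rot u : middle (rot u) = middle u.
Proof.
  destruct u as [[a b] c]; unfold rot, middle, csum.
  replace (c + a + b) with (a + b + c) by lia.
  destruct (Z.eqb_spec a b), (Z.eqb_spec b c), (Z.eqb_spec c a); reflexivity || lia || congruence.
Qed.

Lemma excess_rot m e u : excess m e (rot u) = excess m e u.
Proof. unfold excess, weight; rewrite cnorm_rot, range_rot, middle_rot; reflexivity. Qed.

Lemma zsum_excess_rot m e l : zsum (excess m e) (map rot l) = zsum (excess m e) l.
Proof. rewrite zsum_map; apply zsum_ext; intros; apply excess_rot. Qed.

Lemma zsum_sextant f (s : Z * Z -> cube) M :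
  zsum f (map s (box M)) = bsum M (fun b c => f (s (b, c))).
Proof. rewrite zsum_map; apply zsum_ext; intros [b c] _; reflexivity. Qed.

(** The cubic terms of the tents and the ball cancel. What is left is at least [6 m^2 - 3 m - 3] for
    [e = 0] and [6 m^2 - 6] for [e = 1], against [6 m^2 - 4 m - 2] on the left; both inequalities
    are strict as [m >= 2]. The halves [m / 2] from the right and left middle vertices cancel. *)
Lemma region_excess (m M : nat) e : e = 0 \/ e = 1 -> (2 <= m)%nat -> (2 * m + 2 <= M)%nat ->
  2 * (3 * Z.of_nat m + 1) * (Z.of_nat m - 1) < zsum (excess (Z.of_nat m) e) (region M).
Proof.
  intros He Hm HM.
  pose proof (tent'_eq m M e He ltac:(lia)) as ET'.
  pose proof (tent_pair_eq m M e He ltac:(lia)) as ET.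
  unfold region; rewrite zsum_cons, !zsum_app, !zsum_excess_rot.
  unfold third; rewrite !zsum_app, !zsum_sextant.
  assert (E0 : excess (Z.of_nat m) e (0, 0, 0) = 0).
  { unfold excess, weight; change (cnorm (0, 0, 0)) with 0.
    destruct (Z.leb_spec 0 (1 + e)), (Z.leb_spec 0 (2 * Z.of_nat m + e)); lia. }
  rewrite E0; clear E0.
  assert (Hz : 2 <= Z.of_nat m) by lia.
  set (z := Z.of_nat m) in *; clearbody z.
  unshelve epose proof (bsum_le M _ _ (fun b c => excess_sextantR1 z e b c He Hz)) as B1.
  unshelve epose proof (bsum_le M _ _ (fun b c => excess_sextantR2 z e b c He Hz)) as B2.
  unshelve epose proof (bsum_le M _ _ (fun b c => excess_sextantL1 z e b c He Hz)) as B3.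
  unshelve epose proof (bsum_le M _ _ (fun b c => excess_sextantL2 z e b c He Hz)) as B4.
  rewrite !bsum_sub, bsum_add, bsum_scale in B1.
  rewrite !bsum_sub, bsum_add, bsum_scale in B2.
  rewrite !bsum_sub, bsum_scale in B3.
  rewrite !bsum_sub, bsum_add, bsum_scale in B4.
  fold (tent' M (3 * z + 1 + e)) in B1, B2.
  fold (tent M (3 * z + e - 1)) in B3.
  fold (tent M (3 * z + e)) in B4.
  destruct M as [|M]; [lia |]; rewrite bsum_corner in *.
  assert (Hh : 2 * (z / 2) <= z < 2 * (z / 2) + 2) by (Z.to_euclidean_division_equations; lia).
  pose proof (bsum_diagonal (S M) 1 (z - 1) z ltac:(lia)).
  pose proof (bsum_diagonal (S M) 0 z (z + 1) ltac:(lia)).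
  pose proof (bsum_diagonal (S M) (-1) z (z + 1) ltac:(lia)).
  pose proof (bsum_diagonal (S M) 1 (z / 2) (z - 1 + e) ltac:(lia)).
  pose proof (bsum_diagonal (S M) 0 (z - z / 2) z ltac:(lia)).
  (* Multiplying the triangle counts by [3 z + 1] beforehand leaves a goal that is linear in its
     monomials. *)
  assert (HN : forall t q, 2 * t <= q -> 2 * (3 * z + 1) * t <= (3 * z + 1) * q) by (intros; nia).
  pose proof (HN _ _ (bsum_triangle (S M) (z - 1) ltac:(lia))).
  pose proof (HN _ _ (bsum_triangle (S M) (z - 2 + e) ltac:(lia))).
  pose proof (HN _ _ (bsum_triangle (S M) (z - 1 + e) ltac:(lia))).
  clear HN; destruct He as [-> | ->]; lia.
Qed.

(** * Counting colours *)

Lemma NoDup_list_prod {A B} (l : list A) (l' : list B) :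
  NoDup l -> NoDup l' -> NoDup (list_prod l l').
Proof.
  intros Hl Hl'; induction Hl as [|a l Ha Hl IH]; simpl; [constructor |].
  apply NoDup_app; [| exact IH |].
  - apply FinFun.Injective_map_NoDup; [intros b b' E; congruence | exact Hl'].
  - intros [a' b] H1 H2; apply in_map_iff in H1; destruct H1 as [b' [E _]].
    apply in_prod_iff in H2; injection E as -> ->; tauto.
Qed.

Lemma NoDup_box M : NoDup (box M).
Proof.
  assert (H : NoDup (upto M))
    by (apply FinFun.Injective_map_NoDup; [intros a b; lia | apply seq_NoDup]).
  apply NoDup_list_prod; exact H.
Qed.

(** The four sextants of [third] as sign conditions, without the size bound: disjointness and
    covering by the three rotated copies become questions about signs. *)
Definition third_shape (u : cube) : Prop :=
  let '(a, b, c) := u in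
  (a + b + c = 0 /\ (0 < b /\ 0 <= c \/ b < 0 /\ c <= 0)) \/
  (a + b + c = 1 /\ (0 < b /\ 0 < c \/ b <= 0 /\ c <= 0)).

Ltac in_sextant H :=
  apply in_map_iff in H; destruct H as [[? ?] [H ?]];
  match goal with Hb : In _ (box _) |- _ => apply in_box in Hb; simpl in Hb end;
  injection H as ? ? ?.

Lemma third_sound M u : In u (third M) -> third_shape u.
Proof.
  destruct u as [[a b] c]; unfold third, third_shape; rewrite !in_app_iff.
  intros [H | [H | [H | H]]]; in_sextant H; lia.
Qed.

Lemma NoDup_third M : NoDup (third M).
Proof.
  pose proof (NoDup_box M).
  unfold third; repeat apply NoDup_app;
    try (apply FinFun.Injective_map_NoDup;
         [intros [b c] [b' c'] E; injection E as ? ? ?; f_equal; lia | assumption]);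
    intros [[a b] c] H1 H2; rewrite ?in_app_iff in H2; in_sextant H1;
    repeat destruct H2 as [H2 | H2]; in_sextant H2; lia.
Qed.

Lemma NoDup_region M : NoDup (region M).
Proof.
  assert (I : FinFun.Injective rot)
    by (intros [[a b] c] [[a' b'] c'] E; injection E as -> -> ->; reflexivity).
  pose proof (NoDup_third M) as H0.
  pose proof (FinFun.Injective_map_NoDup I H0) as H1.
  pose proof (FinFun.Injective_map_NoDup I H1) as H2.
  assert (S1 : forall v, In v (map rot (third M)) ->
    exists a b c, v = (c, a, b) /\ third_shape (a, b, c)).
  { intros v Hv; apply in_map_iff in Hv; destruct Hv as [[[a b] c] [<- Hv]].
    apply third_sound in Hv; exists a, b, c; split; [reflexivity | exact Hv]. }
  assert (S2 : forall v, In v (map rot (map rot (third M))) ->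
    exists a b c, v = (b, c, a) /\ third_shape (a, b, c)).
  { intros v Hv; apply in_map_iff in Hv; destruct Hv as [v' [<- Hv]].
    apply S1 in Hv; destruct Hv as (a & b & c & -> & Hv); exists a, b, c; split;
      [reflexivity | exact Hv]. }
  unfold region; constructor.
  - rewrite !in_app_iff; intros [H | [H | H]].
    + apply third_sound in H; simpl in H; lia.
    + destruct (S1 _ H) as (a & b & c & E & Hs); injection E; intros; subst; simpl in Hs; lia.
    + destruct (S2 _ H) as (a & b & c & E & Hs); injection E; intros; subst; simpl in Hs; lia.
  - apply NoDup_app; [exact H0 | apply NoDup_app; [exact H1 | exact H2 |] |]; intros v Hv Hw.
    + destruct (S1 _ Hv) as (a & b & c & -> & Hs).
      destruct (S2 _ Hw) as (a' & b' & c' & E & Hs'); injection E; intros; subst.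
      simpl in Hs, Hs'; lia.
    + rewrite in_app_iff in Hw; apply third_sound in Hv; destruct Hw as [Hw | Hw].
      * destruct (S1 _ Hw) as (a & b & c & -> & Hs); simpl in Hv, Hs; lia.
      * destruct (S2 _ Hw) as (a & b & c & -> & Hs); simpl in Hv, Hs; lia.
Qed.

Lemma region_good M u : In u (region M) -> cgood u.
Proof.
  assert (T : forall v, In v (third M) -> cgood v)
    by (intros [[a b] c] Hv; apply third_sound in Hv; unfold cgood, csum; simpl in Hv; lia).
  assert (R : forall v, cgood v -> cgood (rot v))
    by (intros [[a b] c]; unfold cgood, csum, rot; lia).
  simpl; rewrite !in_app_iff; intros [<- | [H | [H | H]]].
  - left; reflexivity.
  - auto.
  - apply in_map_iff in H; destruct H as [v [<- H]]; auto.
  - apply in_map_iff in H; destruct H as [v [<- H]].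
    apply in_map_iff in H; destruct H as [w [<- H]]; auto.
Qed.

Lemma third_complete M u : third_shape u -> cnorm u < Z.of_nat M -> In u (third M).
Proof.
  destruct u as [[a b] c]; unfold third_shape, cnorm, cdist, third.
  rewrite !in_app_iff, !in_map_iff; intros [[Hs [H | H]] | [Hs [H | H]]] Hn.
  - left; exists (b - 1, c); split; [unfold sextantR1; repeat f_equal; lia |].
    apply in_box; simpl; lia.
  - right; left; exists (- b - 1, - c); split; [unfold sextantR2; repeat f_equal; lia |].
    apply in_box; simpl; lia.
  - right; right; left; exists (b - 1, c - 1).
    split; [unfold sextantL1; repeat f_equal; lia |].
    apply in_box; simpl; lia.
  - right; right; right; exists (- b, - c).
    split; [unfold sextantL2; repeat f_equal; lia |].
    apply in_box; simpl; lia.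
Qed.

Lemma region_complete M u : cgood u -> cnorm u < Z.of_nat M -> In u (region M).
Proof.
  intros Hg Hn.
  (* Rotation has order 3, so a vertex lies in the copy rotated once exactly when rotating it twice
     more leads into [third], and conversely. *)
  assert (T : u = (0, 0, 0) \/ third_shape u \/ third_shape (rot (rot u))
              \/ third_shape (rot u)).
  { destruct u as [[a b] c]; unfold cgood, csum, third_shape, rot in *.
    destruct (Z.eq_dec a 0) as [-> |]; [destruct (Z.eq_dec b 0) as [-> |] |];
      [destruct (Z.eq_dec c 0) as [-> |]; [left; reflexivity |] | |]; right; lia. }
  simpl; rewrite !in_app_iff.
  assert (R : rot (rot (rot u)) = u) by (destruct u as [[a b] c]; reflexivity).
  destruct T as [-> | [T | [T | T]]]; [left; reflexivity | right ..].
  - left; apply third_complete; assumption.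
  - right; left; rewrite <- R; apply in_map, third_complete; [exact T |].
    rewrite !cnorm_rot; exact Hn.
  - right; right; rewrite <- R; apply in_map, in_map, third_complete; [exact T |].
    rewrite !cnorm_rot; exact Hn.
Qed.

(** * From the weight of colour classes to the number of colours *)

Lemma zsum_filter_split {A} (w : A -> Z) (b : A -> bool) l :
  zsum w l = zsum w (filter b l) + zsum w (filter (fun u => negb (b u)) l).
Proof. induction l as [|a l IH]; simpl; [lia | destruct (b a); simpl; lia]. Qed.

(** Colour classes are removed one at a time, each taking away weight at most [B]. *)
Lemma zsum_colors {A} (w : A -> Z) (col : A -> nat) B cs l : NoDup l ->
  (forall u, In u l -> In (col u) cs) ->
  (forall l', NoDup l' -> incl l' l -> (forall u v, In u l' -> In v l' -> col u = col v) ->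
     zsum w l' <= B) ->
  zsum w l <= B * Z.of_nat (length cs).
Proof.
  revert l; induction cs as [|c cs IH]; intros l Hd Hc Hb.
  - destruct l as [|u l]; [simpl; lia | destruct (Hc u (or_introl eq_refl))].
  - rewrite (zsum_filter_split w (fun u => Nat.eqb (col u) c)).
    assert (H1 : zsum w (filter (fun u => Nat.eqb (col u) c) l) <= B).
    { apply Hb; [apply NoDup_filter, Hd | apply incl_filter |].
      intros u v Hu Hv; apply filter_In in Hu, Hv.
      destruct Hu as [_ Hu], Hv as [_ Hv].
      apply Nat.eqb_eq in Hu, Hv; congruence. }
    assert (H2 : zsum w (filter (fun u => negb (Nat.eqb (col u) c)) l)
                 <= B * Z.of_nat (length cs)).
    { apply IH; [apply NoDup_filter, Hd | |].
      - intros u Hu; apply filter_In in Hu; destruct Hu as [Hu Hn].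
        destruct (Hc u Hu) as [-> |]; [| assumption].
        rewrite Nat.eqb_refl in Hn; discriminate.
      - intros l' Hd' Hi; apply Hb; [exact Hd' |].
        intros u Hu; apply Hi in Hu; apply filter_In in Hu; tauto. }
    simpl length; lia.
Qed.

Lemma cdist_norm u v : cdist u v <= cnorm u + cnorm v.
Proof. destruct u as [[a b] c], v as [[a' b'] c']; unfold cnorm, cdist; lia. Qed.

Lemma weight_nonneg m e u : 0 <= m -> 0 <= weight m e u.
Proof.
  intros Hm; unfold weight.
  destruct (Z.leb_spec (cnorm u) (1 + e)), (Z.ltb_spec (4 * m + e - 1) (cnorm u)); lia.
Qed.

Lemma weight_support m e u : 1 <= m -> 0 < weight m e u -> cnorm u <= 4 * m + e - 1.
Proof.
  intros Hm; unfold weight.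
  destruct (Z.leb_spec (cnorm u) (1 + e)), (Z.ltb_spec (4 * m + e - 1) (cnorm u)); lia.
Qed.

(* A point at distance at most [1 + e] from the origin is near every point of the support. *)
Lemma independent_weight m e l : e = 0 \/ e = 1 -> 2 <= m -> NoDup l ->
  (forall u, In u l -> cgood u /\ 0 < weight m e u) ->
  (forall u v, In u l -> In v l -> u <> v -> far m e u v) ->
  zsum (weight m e) l <= 2 * (3 * m + 1).
Proof.
  intros He Hm Hd Hw Hf.
  destruct (existsb (fun u => cnorm u <=? 1 + e) l) eqn:Hc.
  - apply existsb_exists in Hc; destruct Hc as [u [Hu Hc]]; apply Z.leb_le in Hc.
    assert (E : forall v, In v l -> v = u).
    { intros v Hv; pose proof (weight_support m e v ltac:(lia) (proj2 (Hw v Hv))).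
      assert (D : {v = u} + {v <> u}) by (repeat decide equality).
      destruct D as [| D]; [assumption | exfalso].
      pose proof (Hf u v Hu Hv (not_eq_sym D)) as F; unfold far in F.
      pose proof (cdist_norm u v); lia. }
    destruct l as [|v [|v' l]]; [destruct Hu | |].
    + rewrite (E v (or_introl eq_refl)), zsum_cons; cbn [zsum fold_right]; unfold weight.
      destruct (Z.leb_spec (cnorm u) (1 + e)); lia.
    + exfalso; inversion Hd as [| ? ? Hn]; subst; apply Hn.
      rewrite (E v), (E v') by (simpl; auto); left; reflexivity.
  - apply packing_weight; try assumption; split; [| exact Hf].
    intros u Hu; destruct (Hw u Hu) as [Hg Hp].
    assert (Hn : ~ cnorm u <= 1 + e).
    { intros Hn; apply Bool.not_true_iff_false in Hc; apply Hc, existsb_exists.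
      exists u; split; [exact Hu | apply Z.leb_le, Hn]. }
    pose proof (weight_support m e u ltac:(lia) Hp).
    unfold outer; intuition lia.
Qed.

Lemma region_weight (m M : nat) e : e = 0 \/ e = 1 -> (2 <= m)%nat -> (2 * m + 2 <= M)%nat ->
  2 * (3 * Z.of_nat m + 1) *
    (Z.of_nat (length (filter (fun u => cnorm u <=? 2 * Z.of_nat m + e) (region M)))
     + Z.of_nat m - 1)
  < zsum (weight (Z.of_nat m) e)
      (filter (fun u => 0 <? weight (Z.of_nat m) e u) (region M)).
Proof.
  intros He Hm HM; pose proof (region_excess m M e He Hm HM) as H.
  set (z := Z.of_nat m) in *.
  assert (E : zsum (excess z e) (region M) = zsum (weight z e) (region M) -
    2 * (3 * z + 1) * Z.of_nat (length (filter (fun u => cnorm u <=? 2 * z + e) (region M)))).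
  { clear H; unfold excess; induction (region M) as [|u l IH]; [simpl; lia |].
    rewrite !zsum_cons, IH; cbn [filter].
    destruct (cnorm u <=? 2 * z + e); cbn [length]; lia. }
  assert (P : zsum (weight z e) (filter (fun u => 0 <? weight z e u) (region M)) =
              zsum (weight z e) (region M)).
  { clear H E; induction (region M) as [|u l IH]; [reflexivity |].
    cbn [filter]; pose proof (weight_nonneg z e u ltac:(lia)).
    destruct (Z.ltb_spec 0 (weight z e u)); rewrite !zsum_cons; lia. }
  lia.
Qed.

Theorem theorem3 (p : nat) (x : vertex) (n : nat) (f : vertex -> nat) :
  (5 <= p)%nat ->
  right_vertex x ->
  distance_coloring (2 * p) n f ->
  (* at least floor(p/2) distinct colours appearing on
     the union of F_{x,p+q}, 1 <= q <= 2 floor(p/2) - 1,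
     and not appearing on V(D_x^{2p}) *)
  (exists cs : list nat,
     NoDup cs /\ (p / 2 <= length cs)%nat /\
     forall c, In c cs ->
       (exists u q, (1 <= q <= 2 * (p / 2) - 1)%nat /\ dist_eq x u (p + q) /\ f u = c) /\
       (forall w, dist_le x w p -> f w <> c))
  /\
  (* consequently n >= |V(D_x^{2p})| + floor(p/2) *)
  (forall D : list vertex,
     NoDup D -> (forall w, In w D <-> dist_le x w p) ->
     (length D + p / 2 <= n)%nat).
Proof.
  intros Hp Hx [Hrange Hf].
  assert (Hnew : exists cs : list nat,
     NoDup cs /\ (p / 2 <= length cs)%nat /\
     forall c, In c cs ->
       (exists u q, (1 <= q <= 2 * (p / 2) - 1)%nat /\ dist_eq x u (p + q) /\ f u = c) /\
       (forall w, dist_le x w p -> f w <> c)).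
  { assert (Hm : (2 <= p / 2)%nat) by (apply Nat.div_le_lower_bound; lia).
    pose proof (Nat.div_mod_eq p 2) as Hdm; pose proof (Nat.mod_upper_bound p 2 ltac:(lia)) as Hmod.
    set (m := (p / 2)%nat) in *; set (e := Z.of_nat (p mod 2)).
    assert (He : e = 0 \/ e = 1) by lia.
    assert (Hpe : Z.of_nat p = 2 * Z.of_nat m + e) by lia.
    clearbody m e; clear Hdm Hmod.
    (* The side [2 m + 2] exceeds [p], so [R] contains the ball of radius [p]; it also meets the
       size condition of [region_weight]. *)
    set (R := region (2 * m + 2)).
    set (V := filter (fun u => 0 <? weight (Z.of_nat m) e u) R).
    set (B := filter (fun u => cnorm u <=? 2 * Z.of_nat m + e) R).
    set (col u := f (emb x u)).
    set (all := nodup Nat.eq_dec (map col V)).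
    set (new := filter (fun c => negb (existsb (Nat.eqb c) (map col B))) all).
    assert (HV : forall u, In u V -> cgood u /\ 0 < weight (Z.of_nat m) e u).
    { intros u Hu; apply filter_In in Hu; destruct Hu as [Hu Hw].
      apply Z.ltb_lt in Hw; split; [apply (region_good _ _ Hu) | exact Hw]. }
    assert (Hall : zsum (weight (Z.of_nat m) e) V
                   <= 2 * (3 * Z.of_nat m + 1) * Z.of_nat (length all)).
    { apply (zsum_colors _ col).
      - apply NoDup_filter, NoDup_region.
      - intros u Hu; apply nodup_In, in_map, Hu.
      - intros l Hd Hi Hc; apply independent_weight; [exact He | lia | exact Hd | auto |].
        intros u v Hu Hv Huv.
        destruct (HV u (Hi u Hu)) as [Gu _], (HV v (Hi v Hv)) as [Gv _].
        unfold far; apply Z.nlt_ge; intros Hlt.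
        apply (Hf (emb x u) (emb x v)).
        + intros E; apply Huv, (emb_inj x); assumption.
        + apply dist_le_emb; try assumption; lia.
        + apply Hc; assumption. }
    pose proof (region_weight m (2 * m + 2) e He Hm ltac:(lia)) as HW.
    fold R V B in HW.
    assert (Hlen : (length all <= length new + length B)%nat).
    { rewrite <- (length_map col B), <- length_app.
      apply NoDup_incl_length; [apply NoDup_nodup |].
      intros c Hc; apply in_app_iff.
      destruct (existsb (Nat.eqb c) (map col B)) eqn:E.
      - right; apply existsb_exists in E; destruct E as [c' [Hc' E]].
        apply Nat.eqb_eq in E; subst c'; exact Hc'.
      - left; apply filter_In; split; [exact Hc | rewrite E; reflexivity]. }
    (* Cancelling [2 (3 m + 1)] in [HW] and [Hall] gives [length B + m - 1 < length all], and
       [length all] is at most [length new + length B]. *)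
    exists new; split; [apply NoDup_filter, NoDup_nodup | split; [nia |]].
    intros c Hc; apply filter_In in Hc; destruct Hc as [Hc HB].
    assert (HB' : forall u, cgood u -> cnorm u <= Z.of_nat p -> col u <> c).
    { intros u Gu Nu E; apply negb_true_iff, not_true_iff_false in HB; apply HB.
      apply existsb_exists; exists c; split; [| apply Nat.eqb_refl].
      rewrite <- E; apply in_map, filter_In; split.
      - apply region_complete; [exact Gu | lia].
      - apply Z.leb_le; lia. }
    split.
    - apply nodup_In, in_map_iff in Hc; destruct Hc as [u [Hc Hu]].
      destruct (HV u Hu) as [Gu Wu].
      apply weight_support in Wu; [| lia].
      assert (Hn : Z.of_nat p < cnorm u)
        by (apply Z.nle_gt; intros Hn; exact (HB' u Gu Hn Hc)).
      (* The support ends at norm [4 m + e - 1], which is [p + (2 m - 1)]: exactly the last sphere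
         allowed. *)
      exists (emb x u), (Z.to_nat (cnorm u) - p)%nat.
      split; [lia | split; [| exact Hc]].
      apply dist_eq_emb; [exact Hx | exact Gu |]; unfold cnorm in *; lia.
    - intros w Hw; destruct (dist_le_inv _ _ _ Hx Hw) as [u [Gu [-> Hn]]].
      apply HB'; assumption. }
  split; [exact Hnew |].
  destruct Hnew as [cs [Hcs [Hlen Hc]]]; intros D HD HDx.
  (* Two vertices of the ball are within [2 p] of each other through [x], so [f] is injective on
     [D]; together with the new colours its values are distinct elements of [1, ..., n]. *)
  assert (Hinj : NoDup (map f D)).
  { apply FinFun.Injective_map_NoDup_in; [| exact HD].
    intros u v Hu Hv E; apply HDx in Hu, Hv.
    destruct (dist_le_inv _ _ _ Hx Hu) as [u' [Gu [-> Nu]]].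
    destruct (dist_le_inv _ _ _ Hx Hv) as [v' [Gv [-> Nv]]].
    assert (T : {u' = v'} + {u' <> v'}) by (repeat decide equality).
    destruct T as [-> | T]; [reflexivity | exfalso].
    apply (Hf (emb x u') (emb x v')); [| | exact E].
    - intros E'; apply T, (emb_inj x); assumption.
    - apply dist_le_emb; try assumption.
      pose proof (cdist_norm u' v') as Ht; unfold cnorm in Ht; lia. }
  assert (H : NoDup (map f D ++ cs)).
  { apply NoDup_app; [exact Hinj | exact Hcs |].
    intros c H1 H2; apply in_map_iff in H1; destruct H1 as [w [E Hw]].
    apply (proj2 (Hc c H2) w); [apply HDx, Hw | exact E]. }
  assert (Hincl : incl (map f D ++ cs) (seq 1 n)).
  { intros c Hin; apply in_seq.
    assert (E : exists w, f w = c).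
    { apply in_app_iff in Hin; destruct Hin as [Hin | Hin].
      - apply in_map_iff in Hin; destruct Hin as [w [E _]]; exists w; exact E.
      - destruct (Hc c Hin) as [(u & q & _ & _ & E) _]; exists u; exact E. }
    destruct E as [w <-]; specialize (Hrange w); lia. }
  pose proof (NoDup_incl_length H Hincl) as H'.
  rewrite length_app, length_map, length_seq in H'; lia.
Qed.
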